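(* Let $T\colon X\to X$ be a continuous map on a compact metric space and let $\Phi=\{\phi_1,\ldots,\phi_d\}$ be a family of continuous functions $\phi_i\colon X\to\mathbb{R}$. Given a continuous function $F\colon\mathbb{R}^d\to\mathbb{R}$, if the pair $(T,\Phi)$ has an abundance of ergodic measures, then $$P_F(\Phi)=\sup_{\mu\in\mathcal{M}}\left\{h_\mu(T)+F\left(\int_X\Phi\,d\mu\right)\right\},$$ where $\int_X\Phi\,d\mu=\left(\int_X\phi_1\,d\mu,\ldots,\int_X\phi_d\,d\mu\right)$.
   Context: $\mathcal{M}$ is the set of $T$-invariant Borel probability measures on $X$ and $h_\mu(T)$ is the Kolmogorov–Sinai entropy. The pair $(T,\Phi)$ has an abundance of ergodic measures if for each $\mu\in\mathcal{M}$ and $\epsilon>0$ there exists an ergodic measure $\nu\in\mathcal{M}$ such that $h_\nu(T)\ge h_\mu(T)-\epsilon$ and $\left|\int_X\phi_i\,d\nu-\int_X\phi_i\,d\mu\right|<\epsilon$ for $i=1,\ldots,d$. Let $d$ also denote the metric of $X$. For $n\in\mathbb{N}$ let $d_n(x,y)=\max\{d(T^k(x),T^k(y)):k=0,\ldots,n-1\}$; a set $E\subset X$ is $(n,\epsilon)$-separated if $d_n(x,y)>\epsilon$ for all $x,y\in E$ with $x\ne y$. With $S_n\phi=\sum_{k=0}^{n-1}\phi\circ T^k$, the nonlinear topological pressure of $\Phi$ is $$P_F(\Phi)=\lim_{\epsilon\to0}\limsup_{n\to\infty}\frac1n\log\sup_E\sum_{x\in E}\exp\left[nF\left(\frac{S_n\phi_1(x)}{n},\ldots,\frac{S_n\phi_d(x)}{n}\right)\right],$$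 with the supremum over all $(n,\epsilon)$-separated sets $E$. *)

(* Defs.v *)
(* MathComp-Analysis development; R : realType plays the role of the real line. *)
From HB Require Import structures.
From mathcomp Require Import all_boot all_order all_algebra.
From mathcomp Require Import all_classical all_reals all_analysis.

Set Implicit Arguments.
Unset Strict Implicit.
Unset Printing Implicit Defensive.

Import Order.TTheory GRing.Theory Num.Theory.
Import numFieldNormedType.Exports.

Local Open Scope classical_set_scope.
Local Open Scope ring_scope.

(* The library's measurable types are pointed, so the Borel sigma-algebra of a
   metric space is available only for nonempty spaces; the base point is
   arbitrary and is never used. *)
#[short(type="pointedMetricType")]
HB.structure Definition PointedMetric (R : numDomainType) :=
  {X of Pointed X & Metric R X}.

Definition borel (X : ptopologicalType) := g_sigma_algebraType (@open X).

Section entropy.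
Context {d : measure_display} {Y : measurableType d} {R : realType}.
Implicit Types (mu : probability Y R) (T : Y -> Y).

Definition invariant_measure mu T : Prop :=
  forall B, measurable B -> mu (T @^-1` B) = mu B.

Definition ergodic_measure mu T : Prop :=
  invariant_measure mu T /\
  forall B, measurable B -> T @^-1` B = B -> mu B = 0%E \/ mu B = 1%E.

(* Some cells may be empty; these do not contribute to the entropy. *)
Definition finite_partition (m : nat) (A : 'I_m -> set Y) : Prop :=
  [/\ forall i, measurable (A i),
      trivIset [set: 'I_m] A &
      \bigcup_i A i = [set: Y]].

(* The usual convention 0 log 0 = 0 holds since the factor 0 kills the
   logarithm. *)
Definition family_entropy mu (I : finType) (B : I -> set Y) : R :=
  - \sum_(i : I) fine (mu (B i)) * ln (fine (mu (B i))).

(* The join of A, T^-1 A, ..., T^-(n-1) A, whose cells are indexed by their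
   itineraries s. *)
Definition dynamical_join T (m : nat) (A : 'I_m -> set Y) (n : nat)
    (s : {ffun 'I_n -> 'I_m}) : set Y :=
  \bigcap_(k in [set: 'I_n]) (iter k T @^-1` A (s k)).

Definition partition_entropy mu T (m : nat) (A : 'I_m -> set Y) : R :=
  lim (family_entropy mu (dynamical_join T A (n := n)) / n%:R @[n --> \oo]).

Definition ks_entropy mu T : \bar R :=
  ereal_sup [set h : \bar R | exists (m : nat) (A : 'I_m -> set Y),
    finite_partition A /\ h = (partition_entropy mu T A)%:E].

End entropy.

Definition invariant_borel_measures (R : realType) (X : pointedMetricType R)
    (T : X -> X) : set (probability (borel X) R) :=
  [set mu : probability (borel X) R | invariant_measure mu T].

Definition abundance_of_ergodic_measures (R : realType)
    (X : pointedMetricType R) (T : X -> X) (d : nat) (phi : 'I_d -> X -> R) :=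
  forall (mu : probability (borel X) R) (e : R),
    invariant_borel_measures T mu -> 0 < e ->
    exists nu : probability (borel X) R,
      [/\ ergodic_measure nu T,
          (ks_entropy mu T - e%:E <= ks_entropy nu T)%E &
          forall i, `| \int[nu]_x phi i x - \int[mu]_x phi i x | < e].

Section pressure.
Context {R : realType} {X : pointedMetricType R}.
Implicit Types (T : X -> X).

Definition bowen_dist T (n : nat) (x y : X) : R :=
  \big[Num.max/0]_(k < n) mdist (iter k T x) (iter k T y).

Definition separated T (n : nat) (e : R) (E : set X) : Prop :=
  forall x y, E x -> E y -> x <> y -> e < bowen_dist T n x y.

Definition birkhoff_sum T (n : nat) (f : X -> R) (x : X) : R :=
  \sum_(k < n) f (iter k T x).

Definition separated_sup T (d : nat) (phi : 'I_d -> X -> R)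
    (F : 'rV[R]_d -> R) (n : nat) (e : R) : \bar R :=
  ereal_sup [set \esum_(x in E)
      (expR (n%:R * F (\row_i (birkhoff_sum T n (phi i) x / n%:R))))%:E
    | E in separated T n e].

Definition nonlinear_pressure T (d : nat) (phi : 'I_d -> X -> R)
    (F : 'rV[R]_d -> R) : \bar R :=
  lim (limn_esup (fun n => (n%:R^-1)%:E * lne (separated_sup T phi F n e))%E
    @[e --> 0^'+]).

End pressure.

(* Main.v *)
Require Import Defs.
From HB Require Import structures.
From mathcomp Require Import all_boot all_order all_algebra.
From mathcomp Require Import all_classical all_reals all_analysis.
From mathcomp Require Import measurable_realfun lra ring.

Set Implicit Arguments.
Unset Strict Implicit.
Unset Printing Implicit Defensive.

Import Order.TTheory GRing.Theory Num.Theory.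
Import numFieldNormedType.Exports.

Local Open Scope classical_set_scope.
Local Open Scope ring_scope.

(** Write L(e) for the exponential growth rate of the separated sums at scale e;
    L is nonincreasing in e, so the pressure is the supremum of the L(e).

    L(e) <= sup: split the compact range of the Birkhoff averages into finitely
    many small cells; along infinitely many n one fixed cell, around a vector v,
    carries a positive proportion of the separated sum, so its points form an
    (n, e)-separated set E_n with about exp(n (c - F v)) elements, c < L(e).
    The empirical measures of the orbits of E_n converge along an ultrafilter to
    a finitely additive, T-invariant set function l on all subsets of X.
    Caratheodory's construction turns l into a Borel probability mu that is at
    most l on open sets; hence mu is invariant, agrees with l on sets with null
    boundary, and Misiurewicz's argument on a fine partition into such sets
    gives h_mu >= c - F v, while the integrals of phi are close to v.

    L(e) >= h_nu + F(int Phi d nu) - small, for nu ergodic: given a partition,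
    choose closed subsets K_i of its cells with nearly full measure. By the
    ergodic theorem most points have averages close to int Phi d nu and spend
    few times outside the union of the K_i. For small e the points of a Bowen
    e-ball with this property have few itineraries, so the entropy of the n-th
    join bounds from below the cardinality of separated sets of such points.
    Abundance reduces the case of an invariant measure to the ergodic case. *)

(** The nonlinearity of [F] shapes both halves. The weights are exponentials of [n F] of an average,
    not of a Birkhoff sum, so they do not split along orbits. Inside one small cell, however, they
    are all comparable up to a factor [exp(n e)], and the uniform law on [E_n] can replace a
    weighted one. For the converse, [F] of the typical averages is related to [F(int Phi d nu)] only
    when the averages concentrate at the integral, which is what ergodicity provides.

    An ultrafilter gives a limit on every subset at once. The price is countable additivity: mass
    may move to boundaries, and what relates [mu] to [l] is an inequality on open sets. Hence every
    comparison of the two goes through sets squeezed between an open and a closed set of equal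
    [mu]-measure.

    In the lower bound, the entropy of the join is compared with the logarithm of the number of
    itineraries of good points, the bad points contributing at most their mass times [n ln m]. For
    this, convergence in measure of finitely many averages suffices, and it is the form of the
    ergodic theorem proved here. *)

(** * Shannon entropy of finite distributions *)

Definition shannon (R : realType) (I : finType) (p : I -> R) : R :=
  - \sum_i p i * ln (p i).

Section finite_entropy.
Context {R : realType}.

Lemma ln_leB1 (x : R) : 0 < x -> ln x <= x - 1.
Proof.
move=> x0; have := @le_ln1Dx R (x - 1).
by rewrite addrCA subrr addr0; apply; lra.
Qed.

(** Nonnegativity of relative entropy, from [ln x <= x - 1] at [x = q i / p i]. As [ln 0 = 0] here,
    the support condition replaces the usual infinite value. The total mass of [q] may be smaller
    than that of [p], which the mixture of uniform laws below exploits. *)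
Lemma gibbs (I : finType) (p q : I -> R) :
  (forall i, 0 <= p i) -> (forall i, 0 <= q i) ->
  (forall i, q i = 0 -> p i = 0) -> \sum_i q i <= \sum_i p i ->
  shannon p <= - \sum_i p i * ln (q i).
Proof.
move=> p0 q0 qp qlep; rewrite /shannon lerN2 -subr_ge0 -sumrB.
have : \sum_i (p i - q i) <= \sum_i (p i * ln (p i) - p i * ln (q i)).
  apply: ler_sum => i _.
  have [pi0|pi0] := eqVneq (p i) 0.
    by rewrite pi0 !mul0r subrr sub0r oppr_le0.
  have qi0 : q i != 0 by apply/eqP => /qp; apply/eqP.
  have pip : 0 < p i by rewrite lt_neqAle eq_sym pi0 p0.
  have qip : 0 < q i by rewrite lt_neqAle eq_sym qi0 q0.
  have := ln_leB1 (divr_gt0 qip pip); rewrite ln_div ?posrE// => lnqp.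
  have : p i * (ln (q i) - ln (p i)) <= p i * (q i / p i - 1).
    by rewrite ler_pM2l.
  by rewrite [leRHS]mulrBr mulrCA divff//; lra.
by apply: le_trans; rewrite sumrB subr_ge0.
Qed.

Lemma eq_shannon (I : finType) (p q : I -> R) :
  p =1 q -> shannon p = shannon q.
Proof. by move=> pq; rewrite /shannon; under eq_bigr do rewrite pq. Qed.

Lemma shannon_le_ln_card (I : finType) (p : I -> R) :
  (forall i, 0 <= p i) -> \sum_i p i = 1 -> shannon p <= ln #|I|%:R.
Proof.
move=> p0 p1.
have I0 : (0 < #|I|)%N.
  rewrite lt0n; apply/eqP => /eqP I0; move: p1; rewrite big1 => [/eqP|i _].
    by rewrite eq_sym oner_eq0.
  by move/card0_eq : (eqP I0) => /(_ i); rewrite inE.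
have N0 : 0 < #|I|%:R :> R by rewrite ltr0n.
apply: (le_trans (@gibbs I p (fun=> #|I|%:R^-1) p0 _ _ _)).
- by move=> i; rewrite invr_ge0 ltW.
- by move=> i /eqP; rewrite invr_eq0 gt_eqF.
- by rewrite sumr_const p1 -[_ *+ _]mulr_natr mulVf// gt_eqF.
- by rewrite -mulr_suml p1 mul1r lnV ?posrE// opprK.
Qed.

(* Gibbs' inequality against the mixture of the uniform laws on J and on I. *)
Lemma shannon_le_concentrated (I : finType) (J : {set I}) (p : I -> R) (a : R) :
  (forall i, 0 <= p i) -> \sum_i p i = 1 -> \sum_(i in ~: J) p i <= a -> a < 1 ->
  shannon p <= ln 2 + ln #|J|%:R + a * ln #|I|%:R.
Proof.
move=> p0 p1 pa a1.
have J0 : (0 < #|J|)%N.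
  rewrite lt0n; apply/eqP => /eqP; rewrite cards_eq0 => /eqP JE.
  by move: pa; rewrite JE leNgt (eq_bigl predT) ?p1 ?a1// => i; rewrite !inE.
have I0 : (0 < #|I|)%N by rewrite (leq_trans J0)// max_card.
have a0 : 0 <= a by apply: le_trans pa; exact: sumr_ge0.
have NJ : 0 < #|J|%:R :> R by rewrite ltr0n.
have NI : 0 < #|I|%:R :> R by rewrite ltr0n.
have lnI : 0 <= ln #|I|%:R :> R by rewrite ln_ge0// ler1n.
have lnJ : 0 <= ln #|J|%:R :> R by rewrite ln_ge0// ler1n.
have ln2 : 0 <= ln 2 :> R by rewrite ln_ge0// ler1n.
pose q i : R := if i \in J then (2 * #|J|%:R)^-1 else (2 * #|I|%:R)^-1.
have q0 i : 0 < q i by rewrite /q; case: ifP; rewrite invr_gt0 mulr_gt0.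
apply: (le_trans (@gibbs I p q p0 _ _ _)).
- by move=> i; rewrite ltW.
- by move=> i /eqP; rewrite gt_eqF.
- rewrite p1 (bigID (mem J))/=.
  rewrite (eq_bigr (fun=> (2 * #|J|%:R)^-1)); last by move=> i iJ; rewrite /q iJ.
  rewrite sumr_const.
  have : \sum_(i | i \notin J) q i <= \sum_(i : I) (2 * #|I|%:R)^-1.
    rewrite [leRHS](bigID (mem J))/= -[leLHS]add0r lerD//.
      by apply: sumr_ge0 => i _; rewrite invr_ge0 mulr_ge0.
    by apply: ler_sum => i /negbTE iJ; rewrite /q iJ.
  have half (k : nat) : 0 < k%:R :> R -> (2 * k%:R)^-1 *+ k = 2^-1 :> R.
    by move=> k0; rewrite -[LHS]mulr_natr invfM -mulrA mulVf ?mulr1// gt_eqF.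
  by rewrite sumr_const !half//; lra.
rewrite -sumrN (bigID (mem J))/=.
have -> : \sum_(i in J) - (p i * ln (q i)) =
    (\sum_(i in J) p i) * (ln 2 + ln #|J|%:R).
  rewrite mulr_suml; apply: eq_bigr => i iJ.
  by rewrite /q iJ lnV ?posrE ?mulr_gt0// lnM ?posrE// mulrN opprK.
have -> : \sum_(i | i \notin J) - (p i * ln (q i)) =
    (\sum_(i in ~: J) p i) * (ln 2 + ln #|I|%:R).
  rewrite mulr_suml; apply: eq_big => [i|i iJ]; first by rewrite inE.
  by rewrite /q (negbTE iJ) lnV ?posrE ?mulr_gt0// lnM ?posrE// mulrN opprK.
have : \sum_(i in J) p i + \sum_(i in ~: J) p i = 1.
  rewrite -p1 [RHS](bigID (mem J))/=; congr (_ + _).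
  by apply: eq_bigl => i; rewrite inE.
have : 0 <= \sum_(i in ~: J) p i by exact: sumr_ge0.
have : 0 <= \sum_(i in J) p i by exact: sumr_ge0.
move: pa; set x := \sum_(i in ~: J) _; set y := \sum_(i in J) _ => xa y0 x0 yx1.
rewrite (_ : y = 1 - x); last lra.
have : x * ln #|I|%:R <= a * ln #|I|%:R by rewrite ler_wpM2r.
have : 0 <= x * ln #|J|%:R by rewrite mulr_ge0.
lra.
Qed.

(** Gibbs' inequality against the product of the two marginals; where a marginal vanishes, so does
    [p]. *)
Lemma shannon_prod (I J : finType) (p : I * J -> R) :
  (forall x, 0 <= p x) -> \sum_x p x = 1 ->
  shannon p <= shannon (fun i => \sum_j p (i, j)) + shannon (fun j => \sum_i p
    (i, j)).
Proof.
move=> p0 p1; set p1' := fun i => _; set p2' := fun j => _.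
have p1'0 i : 0 <= p1' i by exact: sumr_ge0.
have p2'0 i : 0 <= p2' i by exact: sumr_ge0.
have p1E : \sum_i p1' i = 1.
  by rewrite pair_bigA/= -p1; apply: eq_bigr => -[].
have p2E : \sum_i p2' i = 1.
  by rewrite exchange_big pair_bigA/= -p1; apply: eq_bigr => -[].
have pz x : p1' x.1 * p2' x.2 = 0 -> p x = 0.
  move/eqP; rewrite mulf_eq0 => /orP[]/eqP; case: x => i j /=.
    by move/psumr_eq0P => ->.
  by move/psumr_eq0P => ->.
apply: (le_trans (@gibbs _ p (fun x => p1' x.1 * p2' x.2) p0 _ pz _)).
- by move=> x; rewrite mulr_ge0.
- rewrite p1 -(pair_bigA _ (fun i j => p1' i * p2' j))/=.
  by under eq_bigr do rewrite -mulr_sumr p2E mulr1; rewrite p1E.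
rewrite /shannon -opprD lerN2.
have -> : \sum_i p1' i * ln (p1' i) = \sum_x p x * ln (p1' x.1).
  under eq_bigr do rewrite mulr_suml.
  by rewrite pair_bigA/=; apply: eq_bigr => -[].
have -> : \sum_i p2' i * ln (p2' i) = \sum_x p x * ln (p2' x.2).
  under eq_bigr do rewrite mulr_suml.
  by rewrite exchange_big pair_bigA/=; apply: eq_bigr => -[].
rewrite -big_split/=; apply: ler_sum => x _.
have [->|px] := eqVneq (p x) 0; first by rewrite !mul0r addr0.
have : p1' x.1 * p2' x.2 != 0 by apply/eqP => /pz; apply/eqP.
rewrite mulf_eq0 negb_or => /andP[a b].
by rewrite lnM ?posrE ?lt_neqAle 1?eq_sym ?a ?b ?p1'0 ?p2'0// mulrDr.
Qed.

(** Gibbs' inequality for each [p k] against the average [q]: the right-hand sides add up to [n]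
    times the entropy of [q]. *)
Lemma shannon_concave (I : finType) (n : nat) (p : 'I_n -> I -> R) :
  (0 < n)%N -> (forall k i, 0 <= p k i) -> (forall k, \sum_i p k i = 1) ->
  \sum_k shannon (p k) <= n%:R * shannon (fun i => (\sum_k p k i) / n%:R).
Proof.
move=> n0 p0 p1; have N0 : 0 < n%:R :> R by rewrite ltr0n.
set q : I -> R := fun i => (\sum_k p k i) / n%:R.
have q0 i : 0 <= q i by rewrite divr_ge0 ?sumr_ge0.
have q1 : \sum_i q i = 1.
  rewrite -mulr_suml exchange_big/= (eq_bigr (fun=> 1)) ?sumr_const ?card_ord//.
  by rewrite divff// gt_eqF.
have : \sum_k shannon (p k) <= \sum_k - \sum_i p k i * ln (q i).
  apply: ler_sum => k _; apply: gibbs => //.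
    move=> i /eqP; rewrite mulf_eq0 invr_eq0 (gt_eqF N0) orbF => /eqP.
    by move/psumr_eq0P => ->.
  by rewrite q1 p1.
move=> /le_trans; apply.
rewrite sumrN exchange_big/= mulrN lerN2 mulr_sumr; apply: ler_sum => i _.
by rewrite -mulr_suml mulrA mulrCA divff ?mulr1// gt_eqF.
Qed.

End finite_entropy.

(** * Entropy of itineraries *)

Section fekete.
Context {R : realType}.

Lemma subadditive_mul_add (a : nat -> R) (k q r : nat) :
  (forall i j, a (i + j)%N <= a i + a j) ->
  a (k * q + r)%N <= k%:R * a q + a r.
Proof.
move=> aD; elim: k => [|k IH]; first by rewrite mul0n add0n mul0r add0r.
rewrite mulSn -addnA (le_trans (aD _ _))// -natr1 mulrDl mul1r.
by move: IH; lra.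
Qed.

(** The limit is the infimum of [a n / n] over positive [n]: compare with a nearly optimal [q] by
    dividing [n] by [q] with remainder. *)
Lemma fekete (a : nat -> R) :
  (forall n, 0 <= a n) -> (forall i j, a (i + j)%N <= a i + a j) ->
  cvgn (fun n => a n / n%:R).
Proof.
move=> a0 aD.
pose S := [set a n / n%:R | n in [set n | (0 < n)%N]].
have S0 : has_lbound S by exists 0 => _ [n _ <-]; rewrite divr_ge0.
have SI : has_inf S by split=> //; exists (a 1%N / 1%:R); exists 1%N.
apply: (cvgP (inf S)); apply/cvgrPdist_le => e e0.
have e20 : 0 < e / 2 by rewrite divr_gt0.
have [_ [q /= q0 <-] aq] := @inf_adherent _ S _ e20 SI.
(* Bounds every remainder term [a (n %% q)] at once, independently of [n]. *)
pose C := \sum_(r < q) a r.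
have C0 : 0 <= C by exact: sumr_ge0.
have Q0 : 0 < q%:R :> R by rewrite ltr0n.
near=> n.
have n0 : (0 < n)%N by near: n; exists 1%N.
have N0 : 0 < n%:R :> R by rewrite ltr0n.
have lo : inf S <= a n / n%:R by apply: ge_inf => //; exists n.
rewrite distrC ger0_norm ?subr_ge0// lerBlDl ler_pdivrMr//.
have : a n <= (n %/ q)%:R * a q + a (n %% q)%N.
  by rewrite {1}(divn_eq n q); exact: subadditive_mul_add.
move=> /le_trans; apply.
have : a (n %% q)%N <= C.
  rewrite /C (bigD1 (Ordinal (ltn_pmod n q0)))//= lerDl.
  exact: sumr_ge0.
have Ce : C <= n%:R * (e / 2).
  rewrite -ler_pdivrMr//; near: n; exact: nbhs_infty_ger.
have : (n %/ q)%:R * a q <= n%:R * (a q / q%:R).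
  rewrite mulrA ler_pdivlMr// mulrAC ler_wpM2r// -natrM ler_nat.
  exact: leq_trunc_div.
have : n%:R * (a q / q%:R) <= n%:R * (inf S + e / 2).
  by rewrite ler_pM2l// ltW.
move: Ce; rewrite !mulrDr [(_ + _) * _]mulrC !mulrDr; lra.
Unshelve. all: by end_near. Qed.

End fekete.

(** Partitions are handled as labellings [c] with values in a finite type. Joins then become
    pairings of maps, the n-th dynamical join is the labelling by words of length [n], and recoding
    is composition with an injection. *)
Definition itinerary (Y I : Type) (T : Y -> Y) (c : Y -> I) (n : nat) (x : Y) :
  {ffun 'I_n -> I} := [ffun k : 'I_n => c (iter k T x)].

Lemma itinerary_preimage (Y I : Type) (T : Y -> Y) (c : Y -> I) (n : nat)
    (s : {ffun 'I_n -> I}) :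
  itinerary T c n @^-1` [set s] =
  \bigcap_(k in [set: 'I_n]) (iter k T @^-1` (c @^-1` [set s k])).
Proof.
apply/seteqP; split => x /= => [<- k _|H]; first by rewrite ffunE.
by apply/ffunP => k; rewrite ffunE; exact: H.
Qed.

(** * Entropy of labellings under finitely additive set functions *)

Definition label_entropy (R : realType) (Y : Type) (m : set Y -> R)
    (I : finType) (c : Y -> I) : R :=
  shannon (fun i => m (c @^-1` [set i])).

(* Finitely additive set functions on a class M of sets, so that the entropy
   inequalities apply both to measures and to limits of measures along an
   ultrafilter, which are not countably additive. *)
Record fin_additive (R : realType) (Y : Type) (M : set (set Y))
    (m : set Y -> R) : Prop := FinAdditive {
  fadd0 : m set0 = 0;
  fadd_ge0 : forall A, 0 <= m A;
  fadd_total : m setT = 1;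
  fadd_class0 : M set0;
  fadd_classU : forall A B, M A -> M B -> M (A `|` B);
  faddU : forall A B, M A -> M B -> A `&` B = set0 -> m (A `|` B) = m A + m B }.

Section label_entropy.
Context {R : realType} {Y : Type} (M : set (set Y)) (m : set Y -> R).
Hypothesis mA : fin_additive M m.

Lemma fadd_preimage (I : finType) (c : Y -> I) (P : pred I) :
  (forall i, M (c @^-1` [set i])) ->
  m (c @^-1` [set` P]) = \sum_(i | P i) m (c @^-1` [set i]).
Proof.
move=> cM.
have H (s : seq I) : uniq s ->
    M (c @^-1` [set` s]) /\ m (c @^-1` [set` s]) = \sum_(i <- s) m (c @^-1`
      [set i]).
  elim: s => [_|i s IH /= /andP[si us]].
    rewrite (_ : c @^-1` _ = set0) ?big_nil; last by rewrite -subset0 => x.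
    by split; [exact: fadd_class0 mA|exact: fadd0 mA].
  have [MS mS] := IH us.
  have -> : c @^-1` [set` (i :: s)] = c @^-1` [set i] `|` c @^-1` [set` s].
    apply/seteqP; split => x /=; rewrite inE.
      by move=> /orP[/eqP|]; [left|right].
    by move=> [->|->]; rewrite ?eqxx ?orbT.
  rewrite big_cons -mS; split; first exact: (fadd_classU mA).
  apply: (faddU mA) => //; rewrite -subset0 => x /= [xi].
  by rewrite xi (negbTE si).
have [_] := H _ (enum_uniq P).
rewrite big_enum/= => <-; congr (m _); apply/seteqP; split => x /=;
  by rewrite mem_enum.
Qed.

Lemma fadd_sum1 (I : finType) (c : Y -> I) :
  (forall i, M (c @^-1` [set i])) -> \sum_i m (c @^-1` [set i]) = 1.
Proof.
move=> cM; rewrite -(fadd_total mA) -(@fadd_preimage I c predT)//.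
by congr m; apply/seteqP; split.
Qed.

Lemma label_entropy_ge0 (I : finType) (c : Y -> I) :
  (forall i, M (c @^-1` [set i])) -> 0 <= label_entropy m c.
Proof.
move=> cM; rewrite /label_entropy /shannon oppr_ge0.
apply: sumr_le0 => i _; rewrite mulr_ge0_le0 ?(fadd_ge0 mA)// ln_le0//.
rewrite -(fadd_sum1 cM) (bigD1 i)//= lerDl.
by apply: sumr_ge0 => j _; exact: fadd_ge0 mA _.
Qed.

Lemma label_entropy_le_ln_card (I : finType) (c : Y -> I) :
  (forall i, M (c @^-1` [set i])) -> label_entropy m c <= ln #|I|%:R.
Proof.
move=> cM; apply: shannon_le_ln_card; last exact: fadd_sum1.
by move=> i; exact: fadd_ge0 mA _.
Qed.

(** Labels outside the image of [h] have empty cells and contribute 0. *)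
Lemma label_entropy_inj (I J : finType) (h : I -> J) (c : Y -> I) :
  injective h -> label_entropy m (h \o c) = label_entropy m c.
Proof.
move=> hI; congr (- _); rewrite (bigID (fun j => j \in codom h))/=.
rewrite addrC big1 ?add0r => [|j jh]; last first.
  rewrite (_ : _ @^-1` _ = set0) ?(fadd0 mA) ?mul0r// -subset0 => x /= hx.
  by move: jh; rewrite -hx codom_f.
rewrite -big_uniq/=; last by rewrite /codom /image_mem map_inj_uniq ?enum_uniq.
rewrite /codom /image_mem big_map big_enum/=; apply: eq_bigr => i _.
rewrite (_ : (h \o c) @^-1` _ = c @^-1` [set i])//.
by apply/seteqP; split => x /= => [/hI|->].
Qed.

Lemma sum_fst_eq (I J : finType) (G : I * J -> R) (i : I) :
  \sum_(u in [pred u : I * J | u.1 == i]) G u = \sum_j G (i, j).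
Proof.
rewrite (eq_bigr (fun u => G (u.1, u.2))) => [|[]//].
rewrite (eq_bigl (fun u : I * J => pred1 i u.1 && predT u.2)) => [|u].
  by rewrite -(pair_big (pred1 i) predT (fun i j => G (i, j)))/= big_pred1_eq.
by rewrite inE/= andbT.
Qed.

Lemma sum_snd_eq (I J : finType) (G : I * J -> R) (j : J) :
  \sum_(u in [pred u : I * J | u.2 == j]) G u = \sum_i G (i, j).
Proof.
rewrite (eq_bigr (fun u => G (u.1, u.2))) => [|[]//].
rewrite (eq_bigl (fun u : I * J => predT u.1 && pred1 j u.2)) => [|u]//.
rewrite -(pair_big predT (pred1 j) (fun i j => G (i, j)))/=.
by apply: eq_bigr => i _; rewrite big_pred1_eq.
Qed.

Lemma label_entropy_pair (I J : finType) (c : Y -> I) (c' : Y -> J) :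
  (forall i, M ((fun x => (c x, c' x)) @^-1` [set i])) ->
  label_entropy m (fun x => (c x, c' x)) <= label_entropy m c + label_entropy m
    c'.
Proof.
move=> cM; rewrite /label_entropy.
apply: le_trans (shannon_prod _ _) _.
- by move=> i; exact: fadd_ge0 mA _.
- exact: fadd_sum1.
rewrite le_eqVlt; apply/orP; left; apply/eqP; congr (_ + _); apply: eq_shannon.
  move=> i; rewrite (_ : c @^-1` _ =
      (fun x => (c x, c' x)) @^-1` [set` [pred u | u.1 == i]]); last first.
    by apply/seteqP; split => x /= => [->|/eqP//]; rewrite inE/= eqxx.
  by rewrite fadd_preimage// sum_fst_eq.
move=> j; rewrite (_ : c' @^-1` _ =
    (fun x => (c x, c' x)) @^-1` [set` [pred u | u.2 == j]]); last first.
  by apply/seteqP; split => x /= => [->|/eqP//]; rewrite inE/= eqxx.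
by rewrite fadd_preimage// sum_snd_eq.
Qed.

(** A word of length [i + j] is recoded as the pair of its first [i] and last [j] letters. The set
    function may fail to be invariant, as empirical measures do, so the shift by [iter i T] stays in
    the last term. *)
Lemma label_entropy_itinerary (I : finType) (T : Y -> Y) (c : Y -> I) (i j :
  nat) :
  (forall s, M (itinerary T c (i + j) @^-1` [set s])) ->
  label_entropy m (itinerary T c (i + j)) <=
  label_entropy m (itinerary T c i) +
  label_entropy m (itinerary T c j \o iter i T).
Proof.
move=> cM.
pose h (s : {ffun 'I_(i + j) -> I}) :=
  ([ffun k : 'I_i => s (lshift j k)], [ffun k : 'I_j => s (rshift i k)]).
have hI : injective h.
  move=> s t /pair_equal_spec[/ffunP st1 /ffunP st2]; apply/ffunP => k.
  case: (split_ordP k) => k' ->.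
    by have := st1 k'; rewrite !ffunE.
  by have := st2 k'; rewrite !ffunE.
have hE : h \o itinerary T c (i + j) =
    fun x => (itinerary T c i x, (itinerary T c j \o iter i T) x).
  apply/funext => x /=; congr (_, _); apply/ffunP => k; rewrite !ffunE//=.
  by rewrite addnC iterD.
rewrite -(label_entropy_inj _ hI) hE; apply: label_entropy_pair => -[s t].
rewrite -hE comp_preimage.
have [[u hu]|nu] := pselect (exists u, h u = (s, t)).
  rewrite (_ : h @^-1` _ = [set u])//.
  by apply/seteqP; split => v /=; [rewrite -hu => /hI|move=> ->].
rewrite (_ : h @^-1` _ = set0) ?preimage_set0; first exact: fadd_class0 mA.
by rewrite -subset0 => v /= hv; apply: nu; exists v.
Qed.

End label_entropy.

(** * From finitely additive set functions to Borel measures *)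

Section regular_content.
Context {R : realType} {X : ptopologicalType} (l : set X -> R).
Hypothesis lA : fin_additive setT l.

Lemma fadd_le (A B : set X) : A `<=` B -> l A <= l B.
Proof.
move=> AB; rewrite -(setDUK AB).
by rewrite (faddU lA)// ?setDIK// lerDl (fadd_ge0 lA).
Qed.

Lemma fadd_le1 (A : set X) : l A <= 1.
Proof. by rewrite -(fadd_total lA) fadd_le. Qed.

Lemma faddC (A : set X) : l (~` A) = 1 - l A.
Proof.
by rewrite -(fadd_total lA) -(setUv A) (faddU lA) ?setICr//; ring.
Qed.

Lemma fadd_leU (A B : set X) : l (A `|` B) <= l A + l B.
Proof.
rewrite (_ : A `|` B = A `|` (B `\` A)).
  by rewrite (faddU lA) ?setDIK// lerD2l fadd_le//; exact: subDsetl.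
apply/seteqP; split => x [Ax|]; [by left| |by left|by case; right].
by move=> Bx; have [?|?] := pselect (A x); [left|right].
Qed.

(* Regularizing l from inside makes it countably subadditive on open sets, by
   compactness. *)
Definition inner_content (U : set X) : R :=
  sup [set l K | K in [set K | closed K /\ K `<=` U]].

Let inner_has_sup U : has_sup [set l K | K in [set K | closed K /\ K `<=` U]].
Proof.
split; first by exists (l set0); exists set0 => //; split => //; exact: closed0.
by exists 1 => _ [K _ <-]; exact: fadd_le1.
Qed.

Lemma inner_content_ub (K U : set X) :
  closed K -> K `<=` U -> l K <= inner_content U.
Proof.
move=> cK KU; apply: ub_le_sup; first exact: (inner_has_sup U).2.
by exists K.
Qed.

Lemma inner_content_le (U : set X) (r : R) :
  (forall K, closed K -> K `<=` U -> l K <= r) -> inner_content U <= r.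
Proof.
move=> Ur; apply: ge_sup; first exact: (inner_has_sup U).1.
by move=> _ [K [cK KU] <-]; exact: Ur.
Qed.

Lemma inner_content_le_content (U : set X) : inner_content U <= l U.
Proof. by apply: inner_content_le => K _; exact: fadd_le. Qed.

Lemma inner_content_ge0 (U : set X) : 0 <= inner_content U.
Proof. by rewrite -(fadd0 lA); apply: inner_content_ub => //; exact: closed0. Qed.

Lemma inner_content_mono (U V : set X) :
  U `<=` V -> inner_content U <= inner_content V.
Proof.
move=> UV; apply: inner_content_le => K cK KU; apply: inner_content_ub => //.
exact: subset_trans UV.
Qed.

Lemma inner_content_adherent (U : set X) (e : R) : 0 < e ->
  exists K, [/\ closed K, K `<=` U & inner_content U - e < l K].
Proof.
move=> e0; have [_ [K [cK KU] <-] ?] := sup_adherent e0 (inner_has_sup U).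
by exists K.
Qed.

Hypothesis X_normal : normal_space X.

(** A closed [K] in the union is cut into two closed pieces. Normality gives an open [C] around
    [K \ V] contained in a set [W] whose closure lies in [U]. Then [K] is covered by its part in the
    closure of [W], inside [U], and by [K \ C], inside [V]. *)
Lemma inner_contentU (U V : set X) : open U -> open V ->
  inner_content (U `|` V) <= inner_content U + inner_content V.
Proof.
move=> oU oV; apply: inner_content_le => K cK KUV.
have cKV : closed (K `\` V) by rewrite setDE; apply: closedI => //;
  exact: open_closedC.
have KVU : K `\` V `<=` U by move=> x [/KUV[]].
have /(@X_normal _ cKV)[W /set_nbhsP[C [oC KVC CW]] WU] : set_nbhs (K `\` V) U.
  by apply/set_nbhsP; exists U; split.
have cKC : closed (K `\` C) by rewrite setDE; apply: closedI => //;
  exact: open_closedC.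
have cKW : closed (K `&` closure W) by apply: closedI => //;
  exact: closed_closure.
have : l K <= l (K `&` closure W) + l (K `\` C).
  apply: (@le_trans _ _ (l ((K `&` closure W) `|` (K `\` C)))).
    apply: fadd_le => x Kx; have [Cx|nCx] := pselect (C x); last by right.
    by left; split => //; apply: subset_closure; exact: CW.
  exact: fadd_leU.
move=> /le_trans; apply; apply: lerD; apply: inner_content_ub => //.
  by move=> x [_ /WU].
move=> x [Kx nCx]; apply: contrapT => nVx; apply: nCx; exact: KVC.
Qed.

Hypothesis X_compact : compact [set: X].

Lemma inner_content_bigcup (U : (set X)^nat) : (forall n, open (U n)) ->
  ((inner_content (\bigcup_n U n))%:E <= \sum_(n <oo) (inner_content (U n))%:E)%E.
Proof.
move=> oU.
have fin N : inner_content (\big[setU/set0]_(n < N) U n) <= \sum_(n < N)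
  inner_content (U n)
    /\ open (\big[setU/set0]_(n < N) U n).
  elim: N => [|N [IH oN]].
    rewrite !big_ord0; split; last exact: open0.
    by rewrite -(fadd0 lA); apply: inner_content_le_content.
  rewrite !big_ord_recr/=; split; last exact: openU.
  by rewrite (le_trans (inner_contentU _ _))// lerD2r.
have pos n : true -> (0 <= (inner_content (U n))%:E)%E by rewrite lee_fin
  inner_content_ge0.
have [->|soo] := eqVneq (\sum_(n <oo) (inner_content (U n))%:E)%E +oo%E.
  exact: leey.
have sfin : (\sum_(n <oo) (inner_content (U n))%:E)%E \is a fin_num.
  by rewrite ge0_fin_numE ?ltey ?soo// nneseries_ge0// => n _; exact: pos.
rewrite -(fineK sfin) lee_fin; apply: inner_content_le => K cK KU.
have : compact K by apply: subclosed_compact X_compact _.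
rewrite compact_cover => /(_ _ setT U (fun n _ => oU n) KU)[D _ KD].
pose N := (\max_(i <- finmap.enum_fset D) i).+1.
have KN : K `<=` \big[setU/set0]_(n < N) U n.
  move=> x /KD[i /= iD Uix]; rewrite -bigcup_mkord; exists i => //=.
  by rewrite ltnS; apply: (@leq_bigmax_seq _ _ _ (fun i => i)).
apply: le_trans (inner_content_ub cK KN) _; apply: le_trans (fin N).1 _.
rewrite -lee_fin fineK// -sumEFin.
rewrite -(big_mkord xpredT (fun n => (inner_content (U n))%:E)).
by apply: nneseries_lim_ge => n _; exact: pos.
Qed.

Definition outer_content (A : set X) : \bar R :=
  (inf [set inner_content U | U in [set U | open U /\ A `<=` U]])%:E.

Let outer_has_inf A : has_inf [set inner_content U | U in [set U | open U /\ A
  `<=` U]].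
Proof.
split; first by exists (inner_content setT); exists setT => //; split => //;
  exact: openT.
by exists 0 => _ [K _ <-]; exact: inner_content_ge0.
Qed.

Lemma outer_content_lb (A U : set X) : open U -> A `<=` U ->
  (outer_content A <= (inner_content U)%:E)%E.
Proof.
move=> oU AU; rewrite lee_fin; apply: ge_inf; first exact: (outer_has_inf A).2.
by exists U.
Qed.

Lemma outer_content_ge (A : set X) (r : R) :
  (forall U, open U -> A `<=` U -> r <= inner_content U) -> (r%:E <=
    outer_content A)%E.
Proof.
move=> Ar; rewrite lee_fin; apply: lb_le_inf; first exact: (outer_has_inf A).1.
by move=> _ [U [oU AU] <-]; exact: Ar.
Qed.

Lemma outer_content_open (U : set X) :
  open U -> outer_content U = (inner_content U)%:E.
Proof.
move=> oU; apply/eqP; rewrite eq_le outer_content_lb//=.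
by apply: outer_content_ge => V oV UV; exact: inner_content_mono.
Qed.

Lemma outer_content_adherent (A : set X) (e : R) : 0 < e ->
  exists U, [/\ open U, A `<=` U & ((inner_content U)%:E < outer_content A +
    e%:E)%E].
Proof.
move=> e0; have [_ [K [cK KU] <-] ?] := inf_adherent e0 (outer_has_inf A).
by exists K; split => //; rewrite -EFinD lte_fin.
Qed.

Lemma outer_content_ge0 (A : set X) : (0 <= outer_content A)%E.
Proof. by apply: outer_content_ge => U _ _; exact: inner_content_ge0. Qed.

Lemma outer_content0 : outer_content set0 = 0%E.
Proof.
rewrite outer_content_open; last exact: open0.
by congr _%:E; apply/eqP;
  rewrite eq_le inner_content_ge0 -(fadd0 lA) inner_content_le_content.
Qed.

Lemma outer_content_le : {homo outer_content : A B / A `<=` B >-> (A <= B)%E}.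
Proof.
move=> A B AB; apply: outer_content_ge => U oU BU; rewrite -lee_fin.
by apply: outer_content_lb => //; exact: subset_trans BU.
Qed.

Lemma outer_content_sigma_subadditive : sigma_subadditive outer_content.
Proof.
move=> A; apply/lee_addgt0Pr => e e0.
have := @epsilon_trick R (outer_content \o A) e xpredT
  (fun n => outer_content_ge0 _) (ltW e0).
apply: le_trans.
have ee n : 0 < e / (2 ^ n.+1)%:R by rewrite divr_gt0// ltr0n expn_gt0.
have /choice[U HU] n := outer_content_adherent (A n) (ee n).
have oU n : open (U n) by case: (HU n).
apply: (@le_trans _ _ (inner_content (\bigcup_n U n))%:E).
  apply: outer_content_lb; first exact: bigcup_open.
  by apply: subset_bigcup => n _; case: (HU n).
apply: le_trans (inner_content_bigcup oU) _.
apply: lee_nneseries => [n _|n _]; first by rewrite lee_fin inner_content_ge0.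
by case: (HU n) => _ _ /ltW.
Qed.

(** Let [V] be open around [A]. A closed [K] nearly exhausts the part of [V] in [U], and a closed
    [L] nearly exhausts the open set [V \ K], which contains [A \ U]. As [K] and [L] are disjoint
    closed subsets of [V], additivity of [l] bounds the sum by the content of [V]. *)
Lemma outer_content_caratheodory (U A : set X) : open U ->
  (outer_content (A `&` U) + outer_content (A `&` ~` U) <= outer_content A)%E.
Proof.
move=> oU.
have fin B : outer_content B \is a fin_num by [].
rewrite -(fineK (fin (A `&` U))) -(fineK (fin (A `&` ~` U))) -EFinD.
apply: outer_content_ge => V oV AV; apply/ler_addgt0Pl => e e0.
have e2 : 0 < e / 2 by rewrite divr_gt0.
have [K [cK KVU Ke]] := inner_content_adherent (V `&` U) e2.
have [L [cL LVK Le]] := inner_content_adherent (V `\` K) e2.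
have oVK : open (V `\` K) by rewrite setDE; apply: openI => //;
  exact: closed_openC.
have H1 : fine (outer_content (A `&` U)) <= inner_content (V `&` U).
  by rewrite -lee_fin fineK//; apply: outer_content_lb;
    [exact: openI|exact: setSI].
have H2 : fine (outer_content (A `&` ~` U)) <= inner_content (V `\` K).
  rewrite -lee_fin fineK//; apply: outer_content_lb => // x [Ax nUx].
  by split; [exact: AV|move=> /KVU[]].
have H3 : l K + l L <= inner_content V.
  rewrite -(faddU lA)//; last by rewrite -subset0 => x [Kx /LVK[]].
  apply: inner_content_ub; first exact: closedU.
  by move=> x [/KVU[]|/LVK[]].
lra.
Qed.

(** The measure is [outer_content] restricted to Borel sets. On open sets it is [inner_content],
    hence at most [l]; its total mass is 1 because the whole space is closed as well as open. *)
Theorem exists_regular_probability : exists mu : probability (borel X) R,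
  forall U : set X, open U -> (mu U <= (l U)%:E)%E.
Proof.
pose ax := isOuterMeasure.Build R X outer_content outer_content0
  outer_content_ge0 outer_content_le outer_content_sigma_subadditive.
pose om : {outer_measure set X -> \bar R} := HB.pack outer_content ax.
have borel_cara : (@measurable _ (borel X)) `<=` om.-caratheodory.
  apply: smallest_sub.
    split; first exact: caratheodory_measurable_set0.
      by move=> A mA; rewrite setTD; exact: caratheodory_measurable_setC.
    by move=> F mF; exact: caratheodory_measurable_bigcup.
  move=> U oU; apply: le_caratheodory_measurable => A.
  exact: outer_content_caratheodory.
pose P : set (borel X) -> \bar R := outer_content.
have Psa : semi_sigma_additive P.
  move=> F mF tF mUF.
  apply: (@caratheodory_measure_sigma_additive _ _ om) => //.
    by move=> n; exact: borel_cara.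
  exact: borel_cara.
pose mP := isMeasure.Build _ (borel X) R P outer_content0 outer_content_ge0 Psa.
pose mu : {measure set (borel X) -> \bar R} := HB.pack P mP.
have PT : mu setT = 1%E.
  rewrite /mu/= /P outer_content_open; last exact: openT.
  congr _%:E; apply/eqP; rewrite eq_le -{2}(fadd_total lA) -(fadd_total lA).
  by rewrite inner_content_le_content inner_content_ub//; exact: closedT.
pose pP := Measure_isProbability.Build _ (borel X) R mu PT.
pose mu' : probability (borel X) R := HB.pack P mP pP.
exists mu' => U oU; rewrite /mu'/= /P outer_content_open// lee_fin.
exact: inner_content_le_content.
Qed.

End regular_content.

(** * Regularity of Borel probabilities on metric spaces *)

Section probability_fine.
Context {d : measure_display} {Y : measurableType d} {R : realType}.
Implicit Type P : probability Y R.

Lemma fine_probabilityK P (A : set Y) : measurable A -> (fine (P A))%:E = P A.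
Proof. by move=> mA; rewrite fineK// fin_num_measure. Qed.

Lemma fine_probability_le P (A B : set Y) : measurable A -> measurable B ->
  A `<=` B -> fine (P A) <= fine (P B).
Proof.
by move=> mA mB AB; rewrite -lee_fin !fine_probabilityK// le_measure ?inE.
Qed.

Lemma fine_probability_le1 P (A : set Y) : measurable A -> fine (P A) <= 1.
Proof. by move=> mA; rewrite -lee_fin fine_probabilityK// probability_le1. Qed.

Lemma fine_probabilityC P (A : set Y) : measurable A ->
  fine (P (~` A)) = 1 - fine (P A).
Proof.
move=> mA; apply: EFin_inj; rewrite EFinB !fine_probabilityK//.
  by rewrite probability_setC.
exact: measurableC.
Qed.

Lemma fine_probability_leU P (A B : set Y) : measurable A -> measurable B ->
  fine (P (A `|` B)) <= fine (P A) + fine (P B).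
Proof.
move=> mA mB; rewrite -lee_fin EFinD !fine_probabilityK//; first exact: measureU2.
exact: measurableU.
Qed.

Lemma probability_fin_additive P : fin_additive measurable (fine \o P).
Proof.
split => //=.
- by rewrite measure0.
- by move=> A; rewrite fine_ge0.
- by rewrite probability_setT.
- by move=> A B; exact: measurableU.
move=> A B mA mB AB; apply: EFin_inj; rewrite EFinD !fine_probabilityK//.
  by rewrite measureU.
exact: measurableU.
Qed.

Lemma fine_probability_bigcup_cvg0 P (F : (set Y)^nat) :
  (forall n, measurable (F n)) -> nonincreasing_seq F -> \bigcap_n F n = set0 ->
  forall e : R, 0 < e -> \forall n \near \oo, fine (P (F n)) < e.
Proof.
move=> mF niF F0 e e0.
have mIF : measurable (\bigcap_n F n) by exact: bigcap_measurable.
have F0oo : (P (F 0%N) < +oo)%E by rewrite -fine_probabilityK// ltry.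
have := nonincreasing_cvg_mu F0oo mF mIF niF.
rewrite F0 measure0 => /fine_cvgP[_] /cvgrPdist_lt/(_ e e0); apply: filterS => n.
rewrite sub0r normrN; apply: le_lt_trans; exact: ler_norm.
Qed.

End probability_fine.

(** * Approximation by closed sets from inside and open sets from outside *)

Section borel.
Context {R : realType} {X : pointedMetricType R}.

Lemma open_borel (U : set X) : open U -> measurable (U : set (borel X)).
Proof. exact: sub_sigma_algebra. Qed.

Lemma closed_borel (K : set X) : closed K -> measurable (K : set (borel X)).
Proof.
move=> cK; rewrite -(setCK K); apply: measurableC; apply: open_borel.
exact: closed_openC.
Qed.

Lemma continuous_borel (f : X -> X) : continuous f ->
  measurable_fun setT (f : borel X -> borel X).
Proof.
move=> /continuousP cf;
  apply: (@measurability _ _ (borel X) (borel X) setT f open) => //.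
move=> _ [U oU <-]; rewrite setTI; apply: open_borel; exact: cf.
Qed.

Lemma continuous_borel_real (f : X -> R) : continuous f ->
  measurable_fun setT (f : borel X -> R).
Proof.
move=> /continuousP cf;
  apply: (measurability _ (measurable_realfun.RGenOpens.measurableE R)).
move=> _ [_ [a [b ->] <-]]; rewrite setTI; apply: open_borel.
exact/cf/interval_open.
Qed.

Lemma metric_ball_open (x : X) (r : R) : open (ball x r).
Proof.
rewrite openE => y; rewrite ballEmdist/= => xyr; apply/nbhs_ballP.
exists (r - mdist x y); first by rewrite /= subr_gt0.
move=> z; rewrite !ballEmdist/= => yz.
by rewrite (le_lt_trans (metric_triangle x y z))// -ltrBrDl.
Qed.

Lemma metric_closed_ball_closed (x : X) (r : R) : closed [set y :
  X | mdist x y <= r].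
Proof.
rewrite -openC openE => y /= /negP; rewrite -ltNge => xyr; apply/nbhs_ballP.
exists (mdist x y - r); first by rewrite /= subr_gt0.
move=> z; rewrite ballEmdist/= => yz; apply/negP; rewrite -ltNge.
have := metric_triangle x z y; rewrite (metric_sym z y); lra.
Qed.

Lemma closed_bigcap_open (K : set X) : closed K -> exists U : (set X)^nat,
  [/\ forall n, open (U n), nonincreasing_seq U & \bigcap_n U n = K].
Proof.
move=> cK; exists (fun n => \bigcup_(x in K) ball x (n.+1%:R^-1)); split.
- move=> n; apply: bigcup_open => x Kx; exact: metric_ball_open.
- move=> m n mn; apply/subsetPset => x [y Ky yx]; exists y => //.
  by apply: le_ball yx; rewrite lef_pV2 ?posrE// ler_nat.
apply/seteqP; split => x /= => [Kx|Kx n _]; last first.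
  by exists x => //; apply: ballxx.
rewrite (closure_id K).1// => V /nbhs_ballP[e /= e0 eV].
have [n _ /(_ n (leqnn n)) ne] := near_infty_natSinv_lt (PosNum e0).
have [y Ky yx] := Kx n I; exists y; split => //; apply: eV.
by apply: ball_sym; apply: le_ball yx; exact: ltW.
Qed.

(** The approximable sets form a sigma-algebra that contains the closed sets, which are decreasing
    intersections of open sets. For a countable union, the union of the inner closed sets need not
    be closed; it is cut at a finite stage, which costs the second [e / 2]. *)
Lemma borel_regular (P : probability (borel X) R) (B : set (borel X)) :
  measurable B -> forall e : R, 0 < e -> exists K U : set X,
  [/\ closed K, open U, K `<=` B, B `<=` U & fine (P (U `\` K)) < e].
Proof.
pose reg := [set B : set X | measurable (B : set (borel X)) /\
  forall e : R, 0 < e -> exists K U : set X,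
  [/\ closed K, open U, K `<=` B, B `<=` U & fine (P (U `\` K)) < e]].
suff : @measurable _ (borel X) `<=` reg by move=> h /h[].
have mD (U K : set X) : open U -> closed K -> measurable ((U `\` K) :
  set (borel X)).
  by move=> oU cK; apply: measurableD; [exact: open_borel|exact: closed_borel].
have regC A : reg A -> reg (~` A).
  move=> [mA rA]; split; first exact: measurableC.
  move=> e /rA[K [U [cK oU KA AU UK]]]; exists (~` U), (~` K); split.
  - exact: open_closedC.
  - exact: closed_openC.
  - exact: subsetC.
  - exact: subsetC.
  - by rewrite setDE setCK setIC -setDE.
have regK (A : set X) : closed A -> reg A.
  move=> cA; split; first exact: closed_borel.
  move=> e e0; have [U [oU niU UA]] := closed_bigcap_open cA.
  have : \forall n \near \oo, fine (P (U n `\` A)) < e.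
    apply: (@fine_probability_bigcup_cvg0 _ _ _ P (fun n => U n `\` A)) => //.
    - by move=> n; exact: mD.
    - by move=> m n /niU/subsetPset mn; apply/subsetPset; exact: setSD.
    - rewrite -subset0 => x Ux; have : (\bigcap_n U n) x.
        by move=> n _; case: (Ux n I).
      by rewrite UA => Ax; case: (Ux 0%N I).
  move=> [n _ /(_ n (leqnn n))/= ne]; exists A, (U n); split => //.
  by rewrite -UA; apply: bigcap_inf.
apply: smallest_sub; last first.
  by move=> U oU; rewrite -(setCK U); apply/regC/regK; exact: open_closedC.
split.
- by apply: regK; exact: closed0.
- by move=> A; rewrite setTD; exact: regC.
move=> F rF.
have mF n : measurable (F n : set (borel X)) by case: (rF n).
split; first exact: bigcupT_measurable.
move=> e e0; have e20 : 0 < e / 2 by rewrite divr_gt0.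
have ee n : 0 < (e / 2) / (2 ^ n.+1)%:R by rewrite divr_gt0// ltr0n expn_gt0.
have /choice[K] n : exists K U :
  set X, [/\ closed K, open U, K `<=` F n, F n `<=` U &
    fine (P (U `\` K)) < (e / 2) / (2 ^ n.+1)%:R] by case: (rF n) => _ /(_ _
      (ee n)).
move=> /choice[U HKU].
have oU n : open (U n) by case: (HKU n).
have cK n : closed (K n) by case: (HKU n).
have mU n := open_borel (oU n).
have mK n := closed_borel (cK n).
have oUU : open (\bigcup_n U n) by exact: bigcup_open.
have mKK : measurable (\bigcup_n K n :
  set (borel X)) by exact: bigcupT_measurable.
have mUK : measurable ((\bigcup_n U n) `\` (\bigcup_n K n) : set (borel X)).
  by apply: measurableD => //; exact: open_borel.
have UKe : fine (P ((\bigcup_n U n) `\` (\bigcup_n K n))) <= e / 2.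
  rewrite -lee_fin fine_probabilityK//.
  have sub : (\bigcup_n U n) `\` (\bigcup_n K n) `<=` \bigcup_n (U n `\` K n).
    by move=> x [[n _ Ux] nKx]; exists n => //; split=> // Kx; apply: nKx;
      exists n.
  have := measure_sigma_subadditive P (fun n => mD _ _ (oU n) (cK n)) mUK sub.
  move=> /le_trans; apply.
  apply: le_trans (epsilon_trick0 xpredT (ltW e20)).
  apply: lee_nneseries => n _; first by move=> _; exact: measure_ge0.
  rewrite /= -fine_probabilityK; last exact: mD.
  by rewrite lee_fin ltW//; case: (HKU n).
have cKN N : closed (\big[setU/set0]_(n < N) K n).
  by apply: closed_bigsetU => n _.
pose G N := (\bigcup_n K n) `\` \big[setU/set0]_(n < N) K n.
have mG N : measurable (G N : set (borel X)).
  by apply: measurableD => //; exact: closed_borel.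
have : \forall n \near \oo, fine (P (G n)) < e / 2.
  apply: (@fine_probability_bigcup_cvg0 _ _ _ P G) => //.
  - move=> m n mn; apply/subsetPset; apply: setDS.
    exact: (subset_bigsetU (F := K) mn).
  - rewrite -subset0 => x Gx; have [[n _ Kx] _] := Gx 0%N I.
    have [_] := Gx n.+1 I; apply; rewrite -bigcup_mkord; exists n => //=.
move=> [N _ /(_ N (leqnn N))/= Ne].
exists (\big[setU/set0]_(n < N) K n), (\bigcup_n U n); split => //.
- rewrite -bigcup_mkord => x [n _ Kx]; exists n => //.
  by case: (HKU n) => _ _ KF _ _; exact: KF.
- by apply: subset_bigcup => n _; case: (HKU n).
have : fine (P ((\bigcup_n U n) `\` \big[setU/set0]_(n < N) K n)) <=
    fine (P ((\bigcup_n U n) `\` (\bigcup_n K n))) + fine (P (G N)).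
  rewrite -lee_fin EFinD !fine_probabilityK//; last exact: mD.
  apply: le_trans (measureU2 _ _ _) => //.
  apply: le_measure; rewrite ?inE//; [exact: mD|exact: measurableU|].
  move=> x [Ux nKx]; have [Kx|nKx'] := pselect ((\bigcup_n K n) x); last by left.
  by right.
lra.
Qed.

End borel.

(** * Partitions into continuity sets *)

Lemma countable_atoms (d : measure_display) (Y : measurableType d) (R : realType)
    (P : probability Y R) (I : choiceType) (S : I -> set Y) :
  (forall i, measurable (S i)) -> trivIset setT S ->
  countable [set i | fine (P (S i)) != 0].
Proof.
move=> mS tS.
have -> : [set i | fine (P (S i)) != 0] =
    \bigcup_n [set i | n.+1%:R^-1 < fine (P (S i))].
  apply/seteqP; split => i /=; last first.
    by move=> [n _ lt]; rewrite gt_eqF// (lt_trans _ lt)// invr_gt0.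
  move=> Si0; have Si : 0 < fine (P (S i)) by rewrite lt_neqAle eq_sym Si0
    fine_ge0.
  have [n _ /(_ n (leqnn n)) ne] := near_infty_natSinv_lt (PosNum Si).
  by exists n.
apply: bigcup_countable => // n _; apply: finite_set_countable; apply: contrapT.
(* At least [n + 2] disjoint sets of mass above [1 / (n + 1)] would exceed the total mass 1. *)
move=> /(infinite_set_fset n.+2)[B BS nB].
have mB : measurable (\big[setU/set0]_(i <- finmap.enum_fset B) S i).
  by apply: bigsetU_measurable => i _.
have : fine (P (\big[setU/set0]_(i <- finmap.enum_fset B) S i)) <= 1.
  exact: fine_probability_le1.
apply/negP; rewrite -ltNge -lte_fin fine_probabilityK//.
rewrite measure_fbigsetU//; last by apply: sub_trivIset tS.
have -> : (\sum_(i <- finmap.enum_fset B) P (S i) =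
    (\sum_(i <- finmap.enum_fset B) fine (P (S i)))%:E)%E.
  by rewrite -sumEFin; apply: eq_bigr => i _; rewrite fine_probabilityK.
rewrite lte_fin.
have le : \sum_(i <- finmap.enum_fset B) n.+1%:R^-1 <=
    \sum_(i <- finmap.enum_fset B) fine (P (S i)).
  by rewrite big_seq [leRHS]big_seq; apply: ler_sum => i /BS/ltW.
apply: lt_le_trans le.
rewrite big_const_seq count_predT iter_addr_0 -[ltRHS]mulr_natl.
by rewrite ltr_pdivlMr// mul1r ltr_nat; exact: nB.
Qed.

Section continuity_sets.
Context {R : realType} {X : pointedMetricType R}.
Variable P : probability (borel X) R.

(** This says that the boundary of [A] is null. The squeezing pair [U], [K] is kept because it
    passes directly through complements, intersections and preimages by continuous maps. *)
Definition continuity_set (A : set X) : Prop :=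
  measurable (A : set (borel X)) /\ exists U K : set X,
    [/\ open U, closed K, U `<=` A, A `<=` K & fine (P (K `\` U)) = 0].

Let mD (U K : set X) : open U -> closed K -> measurable (K `\` U : set (borel X)).
Proof. by move=> oU cK; apply: measurableD;
  [exact: closed_borel|exact: open_borel]. Qed.

Lemma fine_probability_eq0_sub (A B : set (borel X)) :
  measurable A -> measurable B -> A `<=` B -> fine (P B) = 0 -> fine (P A) = 0.
Proof.
move=> mA mB AB B0; apply/eqP; rewrite eq_le fine_ge0// andbT -B0.
exact: fine_probability_le.
Qed.

Lemma continuity_setT : continuity_set setT.
Proof.
split => //; exists setT, setT; split => //; first exact: openT.
by rewrite setDv measure0.
Qed.

Lemma continuity_setC (A : set X) : continuity_set A -> continuity_set (~` A).
Proof.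
move=> [mA [U [K [oU cK UA AK KU]]]]; split; first exact: measurableC.
exists (~` K), (~` U); split; [exact: closed_openC|exact: open_closedC| | |].
- exact: subsetC.
- exact: subsetC.
- by rewrite setDE setCK setIC -setDE.
Qed.

Lemma continuity_setI (A B : set X) :
  continuity_set A -> continuity_set B -> continuity_set (A `&` B).
Proof.
move=> [mA [U [K [oU cK UA AK KU]]]] [mB [V [L [oV cL VB BL LV]]]].
split; first exact: measurableI.
exists (U `&` V), (K `&` L); split;
  [exact: openI|exact: closedI|exact: setISS|exact: setISS|].
apply: (@fine_probability_eq0_sub _ ((K `\` U) `|` (L `\` V))).
- by apply: mD; [exact: openI|exact: closedI].
- by apply: measurableU; exact: mD.
- move=> x [[Kx Lx]] /not_andP[nU|nV]; [by left|by right].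
apply/eqP; rewrite eq_le fine_ge0// andbT.
by rewrite (le_trans (fine_probability_leU P (mD oU cK) (mD oV cL)))// KU LV
  addr0.
Qed.

Lemma continuity_set0 : continuity_set set0.
Proof. by rewrite -setCT; exact/continuity_setC/continuity_setT. Qed.

(** For turning a finite cover into a partition: each point is labelled by the index of the first
    set of the list that contains it. *)
Lemma continuity_set_find (I : Type) (p : I -> X -> bool) (s : seq I) (k : nat) :
  (forall i, continuity_set [set x | p i x]) ->
  continuity_set [set x | find (p^~ x) s = k].
Proof.
move=> cp; elim: s k => [|i s IH] [|k] /=.
- rewrite (_ : [set _ | _] = setT); first exact: continuity_setT.
  by apply/seteqP; split.
- rewrite (_ : [set _ | _] = set0); first exact: continuity_set0.
  by rewrite -subset0.
- rewrite (_ : [set _ | _] = [set x | p i x])//.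
  by apply/seteqP; split => x /=; case: ifP.
- rewrite (_ : [set _ | _] = ~` [set x | p i x] `&` [set x | find (p^~ x) s = k]).
    by apply: continuity_setI => //; exact: continuity_setC.
  apply/seteqP; split => x /=; case: ifPn => //.
  + by move=> np [].
  + by move=> pix [].
  + by move=> np [_ ->].
Qed.

(** The sets [S e] of points at distance exactly [e] from [x] are disjoint, so only countably many
    have positive mass, whereas the interval of radii has positive Lebesgue measure. *)
Lemma exists_continuity_ball (x : X) (r : R) : 0 < r ->
  exists2 e : R, 0 < e < r & continuity_set (ball x e).
Proof.
move=> r0.
pose S (e : R) := [set y : X | mdist x y <= e] `\` ball x e.
have mS e : measurable (S e : set (borel X)).
  by apply: mD; [exact: metric_ball_open|exact: metric_closed_ball_closed].
have SE e y : S e y -> mdist x y = e.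
  move=> [/= xy]; rewrite ballEmdist/= => /negP; rewrite -leNgt => yx.
  by apply/eqP; rewrite eq_le xy.
have tS : trivIset setT S.
  by apply/trivIsetP => a b _ _; apply: contraNeq => /set0P[y [/SE <- /SE ->]].
suff [e [er Se]] : exists e, 0 < e < r /\ fine (P (S e)) = 0.
  exists e => //; split; first by apply: open_borel; exact: metric_ball_open.
  exists (ball x e), [set y : X | mdist x y <= e]; split => //.
  - exact: metric_ball_open.
  - exact: metric_closed_ball_closed.
  - by move=> y; rewrite ballEmdist/= => /ltW.
apply: contrapT => /forallNP noe.
have : countable (`]0, r[%classic : set R).
  apply: (sub_countable _ (countable_atoms P mS tS));
    apply: subset_card_le => e /=.
  rewrite in_itv/= => er; apply/eqP => Se; exact: (noe e).
move=> /countable_lebesgue_measure0; rewrite lebesgue_measure_itv/= lte_fin r0.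
by rewrite sube0 => -[] /eqP; rewrite gt_eqF.
Qed.

Hypothesis X_compact : compact [set: X].

(** Finitely many balls with null boundary cover the space, and each point of a ball is
    [e / 2]-close to the centre, for the metric and for every [phi i]. Two points with the same
    first ball are compared through its centre. *)
Lemma exists_continuity_partition (d : nat) (phi : 'I_d -> X -> R) (e : R) :
  (forall i, continuous (phi i)) -> 0 < e ->
  exists (m : nat) (c : X -> 'I_m),
    (forall i, continuity_set (c @^-1` [set i])) /\
    forall x y, c x = c y -> mdist x y < e /\ forall i, `|phi i x - phi i y| < e.
Proof.
move=> cphi e0; have e20 : 0 < e / 2 by rewrite divr_gt0.
have H (x : X) : exists r : R, [/\ 0 < r, continuity_set (ball x r) &
    forall y, ball x r y -> mdist x y < e / 2 /\ forall i, `|phi i x - phi i y|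
      < e / 2].
  have : \forall y \near x, ball x (e / 2) y /\ forall i, `|phi i x - phi i y|
    < e / 2.
    apply: filterI; first exact: nbhsx_ballx.
    by apply: filter_forall => i; have /cvgrPdist_lt/(_ _ e20) := cphi i x.
  move=> /nbhs_ballP[r /= r0 rx].
  have [r' /andP[r'0 r'r] cr'] := exists_continuity_ball x r0.
  exists r'; split => // y xy; have [|xy' ?] := rx y; last first.
    by split => //; rewrite ballEmdist in xy'.
  by apply: le_ball xy; exact: ltW.
have [r Hr] := choice H.
have : [set: X] `<=` cover setT (fun x => ball x (r x)).
  by move=> x _; exists x => //; apply: ballxx; case: (Hr x).
move: X_compact; rewrite compact_cover => /(_ _ setT (fun x => ball x (r x))).
move=> /(_ (fun x _ => metric_ball_open x (r x))) /[apply] -[D _ DX].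
pose s := finmap.enum_fset D.
pose p (x y : X) := `[< ball x (r x) y >].
have fs y : (find (p^~ y) s < size s)%N.
  rewrite -has_find; have [x xD xy] := DX y I.
  by apply/hasP; exists x => //; apply/asboolP.
exists (size s), (fun y => Ordinal (fs y)); split.
  move=> i; rewrite (_ : _ @^-1` _ = [set y | find (p^~ y) s = i]).
    apply: continuity_set_find => x; rewrite (_ : [set _ | _] = ball x (r x)).
      by case: (Hr x).
    by apply/seteqP; split => y /= /asboolP.
  by apply/seteqP; split => y /= => [<-//|yi]; apply: val_inj.
move=> y z [yz]; set x := nth y s (find (p^~ y) s).
have hass u : has (p^~ u) s by rewrite has_find.
have /asboolP xy := nth_find y (hass y).
have /asboolP xz := nth_find y (hass z).
rewrite -yz in xz.
have [_ _ Hx] := Hr x; have [d1 p1] := Hx _ xy; have [d2 p2] := Hx _ xz.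
split.
  have := metric_triangle y x z; rewrite (metric_sym y x).
  by move: d1 d2; rewrite -/x; lra.
move=> i; have := p1 i; have := p2 i; rewrite -/x !ltr_norml; lra.
Qed.

End continuity_sets.

(** * Entropy of a partition as a limit *)

Section partition_entropy.
Context {d : measure_display} {Y : measurableType d} {R : realType}.
Variables (P : probability Y R) (T : Y -> Y).
Hypothesis mT : measurable_fun setT T.

Lemma measurable_iter_preimage (n : nat) (A : set Y) :
  measurable A -> measurable (iter n T @^-1` A).
Proof.
move=> mA; elim: n => [//|n IH].
have := mT measurableT IH; rewrite setTI -comp_preimage.
by congr measurable; apply/seteqP; split => x /=; rewrite -iterSr.
Qed.

Lemma invariant_measure_iter (n : nat) (A : set Y) : invariant_measure P T ->
  measurable A -> P (iter n T @^-1` A) = P A.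
Proof.
move=> iP mA; elim: n => [//|n IH].
rewrite -{}IH -[RHS]iP; last exact: measurable_iter_preimage.
by congr (P _); apply/seteqP; split => x /=; rewrite -iterSr.
Qed.

Section label.
Context {I : finType} (c : Y -> I).
Hypothesis mc : forall i, measurable (c @^-1` [set i]).

Lemma measurable_itinerary (n : nat) (s : {ffun 'I_n -> I}) :
  measurable (itinerary T c n @^-1` [set s]).
Proof.
rewrite itinerary_preimage; apply: fin_bigcap_measurable => // k _.
exact: measurable_iter_preimage.
Qed.

Hypothesis iP : invariant_measure P T.

Lemma label_entropy_invariant (J : finType) (c' : Y -> J) (n : nat) :
  (forall j, measurable (c' @^-1` [set j])) ->
  label_entropy (fine \o P) (c' \o iter n T) = label_entropy (fine \o P) c'.
Proof.
by move=> mc'; apply: eq_shannon => j;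
  rewrite /= comp_preimage invariant_measure_iter.
Qed.

Lemma label_entropy_subadditive (i j : nat) :
  label_entropy (fine \o P) (itinerary T c (i + j)) <=
  label_entropy (fine \o P) (itinerary T c i) +
  label_entropy (fine \o P) (itinerary T c j).
Proof.
rewrite -[X in _ + X](label_entropy_invariant i (measurable_itinerary (n := j))).
apply: (label_entropy_itinerary (probability_fin_additive P)).
exact: measurable_itinerary.
Qed.

Lemma cvg_label_entropy :
  cvgn (fun n => label_entropy (fine \o P) (itinerary T c n) / n%:R).
Proof.
apply: fekete; last exact: label_entropy_subadditive.
move=> n; apply: (label_entropy_ge0 (probability_fin_additive P)).
exact: measurable_itinerary.
Qed.

End label.

Lemma finite_partition_label (m : nat) (c : Y -> 'I_m) :
  (forall i, measurable (c @^-1` [set i])) ->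
  finite_partition (fun i => c @^-1` [set i]).
Proof.
move=> mc; split => //.
  by apply/trivIsetP => i j _ _; apply: contraNeq => /set0P[x /= [<- <-]].
by apply/seteqP; split => // x _; exists (c x).
Qed.

Lemma finite_partitionP (m : nat) (A : 'I_m -> set Y) : finite_partition A ->
  exists c : Y -> 'I_m, A = fun i => c @^-1` [set i].
Proof.
move=> [mA tA UA].
have /choice[c Ac] x : exists i, A i x.
  by have : [set: Y] x by []; rewrite -UA => -[i _ Ai]; exists i.
exists c; apply/funext => i; apply/seteqP; split => x /= => [Aix|<-//].
by apply: (tA (c x) i) => //; exists x.
Qed.

Lemma family_entropy_label (m : nat) (c : Y -> 'I_m) (n : nat) :
  family_entropy P (dynamical_join T (fun i => c @^-1` [set i]) (n := n)) =
  label_entropy (fine \o P) (itinerary T c n).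
Proof. by apply: eq_shannon => s; rewrite /= itinerary_preimage. Qed.

(** By Fekete's lemma the [lim] defining [partition_entropy] is a true limit and not a default
    value. *)
Lemma partition_entropy_label_cvg (m : nat) (c : Y -> 'I_m) :
  (forall i, measurable (c @^-1` [set i])) -> invariant_measure P T ->
  label_entropy (fine \o P) (itinerary T c n) / n%:R @[n --> \oo] -->
  partition_entropy P T (fun i => c @^-1` [set i]).
Proof.
move=> mc iP; have := cvg_label_entropy mc iP.
rewrite /partition_entropy.
by under [X in _ -> _ --> lim (X @ _)]eq_fun do rewrite family_entropy_label.
Qed.

End partition_entropy.

(** * Invariance and entropy of the limit measure *)

Section limit_measure.
Context {R : realType} {X : pointedMetricType R}.
Variables (T : X -> X) (l : set X -> R) (P : probability (borel X) R).
Hypothesis X_compact : compact [set: X].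
Hypothesis T_continuous : continuous T.
Hypothesis lA : fin_additive setT l.
Hypothesis lT : forall A, l (T @^-1` A) = l A.
Hypothesis Pl : forall U : set X, open U -> (P U <= (l U)%:E)%E.

Let mT : measurable_fun setT (T : borel X -> borel X) :=
  continuous_borel T_continuous.

Let measurable_preimage (A : set X) : measurable (A : set (borel X)) ->
  measurable (T @^-1` A : set (borel X)).
Proof. by move=> mA; have := mT measurableT mA; rewrite setTI. Qed.

Lemma limit_open (U : set X) : open U -> fine (P U) <= l U.
Proof.
by move=> oU; rewrite -lee_fin fine_probabilityK ?Pl//; exact: open_borel.
Qed.

Lemma limit_closed (K : set X) : closed K -> l K <= fine (P K).
Proof.
move=> cK; have := limit_open (closed_openC cK).
rewrite (faddC lA) fine_probabilityC; last exact: closed_borel.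
lra.
Qed.

(** Chain [P U <= l U <= l A <= l K <= P K], whose two ends agree since [K \ U] is null. *)
Lemma limit_continuity_set (A : set X) : continuity_set P A -> l A = fine (P A).
Proof.
move=> [mA [U [K [oU cK UA AK KU]]]].
have mU := open_borel oU; have mK := closed_borel cK.
have PUK : fine (P K) <= fine (P U).
  have := fine_probability_leU P (measurableD mK mU) mU.
  by rewrite KU add0r; apply: le_trans; apply: fine_probability_le => //;
    [exact: measurableU (measurableD mK mU) mU|move=> x Kx;
      have [|] := pselect (U x); [right|left]].
have := limit_open oU; have := limit_closed cK.
have := fadd_le lA UA; have := fadd_le lA AK.
have := fine_probability_le P mU mA UA.
have := fine_probability_le P mA mK AK.
by move=> *; apply/eqP; rewrite eq_le; apply/andP; split; lra.
Qed.

(** Insert an open [C] with [K] inside [C] and the closure of [C] inside an open [U] of nearly the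
    same measure as [K]. The preimage of [C] is open, so [P] passes to [l], the invariance of [l]
    removes [T], and the closure of [C] leads back to [P]. *)
Lemma limit_preimage_closed (K : set X) : closed K ->
  fine (P (T @^-1` K)) <= fine (P K).
Proof.
move=> cK; apply/ler_addgt0Pr => e e0; have mK := closed_borel cK.
have [L [U [cL oU LK KU UL]]] := borel_regular P mK e0.
have /(@compact_normal X (@metric_hausdorff R X) X_compact _ cK)[W /set_nbhsP[C
  [oC KC CW]] WU] :
    set_nbhs K U by apply/set_nbhsP; exists U; split.
have CU : closure C `<=` U by apply: subset_trans WU; exact: closure_subset.
have mU := open_borel oU; have mL := closed_borel cL; have mC := open_borel oC.
have oTC : open (T @^-1` C) by move/continuousP: T_continuous; apply.
have mcC := closed_borel (@closed_closure _ C).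
apply: le_trans (fine_probability_le P (measurable_preimage mK) (open_borel
  oTC) _) _.
  exact: preimage_subset.
apply: le_trans (limit_open oTC) _; rewrite lT.
apply: le_trans (fadd_le lA (@subset_closure _ C)) _.
apply: le_trans (limit_closed (@closed_closure _ C)) _.
apply: le_trans (fine_probability_le P mcC mU CU) _.
have : fine (P U) <= fine (P (U `\` L)) + fine (P L).
  apply: le_trans (fine_probability_leU P (measurableD mU mL) mL).
  apply: fine_probability_le => //;
    first exact: measurableU (measurableD mU mL) mL.
  by move=> x Ux; have [|] := pselect (L x); [right|left].
have := fine_probability_le P mL mK LK; lra.
Qed.

(** Regularity is applied to the push-forward [Q], since it is the preimage of the closed [L] that
    has to exhaust the preimage of [B]. *)
Lemma limit_preimage_le (B : set (borel X)) : measurable B ->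
  fine (P (T @^-1` B)) <= fine (P B).
Proof.
move=> mB; apply/ler_addgt0Pr => e e0.
pose f : {mfun (borel X) >-> (borel X)} := HB.pack (T : borel X -> borel X)
  (isMeasurableFun.Build _ _ _ _ (T : borel X -> borel X) mT).
pose Q : probability (borel X) R := distribution P f.
have [L [U [cL oU LB BU UL]]] := borel_regular Q mB e0.
have mL := closed_borel cL; have mU := open_borel oU.
have : fine (Q B) <= fine (Q (U `\` L)) + fine (Q L).
  apply: le_trans (fine_probability_leU Q (measurableD mU mL) mL).
  apply: fine_probability_le => //;
    first exact: measurableU (measurableD mU mL) mL.
  by move=> x /BU Ux; have [|] := pselect (L x); [right|left].
have : fine (Q L) <= fine (P L) by exact: limit_preimage_closed.
have := fine_probability_le P mL mB LB.
have -> : fine (Q B) = fine (P (T @^-1` B)) by [].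
lra.
Qed.

Lemma limit_invariant : invariant_measure P T.
Proof.
move=> B mB; have mTB := measurable_preimage mB.
rewrite -(fine_probabilityK P mTB) -(fine_probabilityK P mB); congr _%:E.
apply/eqP; rewrite eq_le limit_preimage_le//=.
(* The inequality for the complement is the reverse inequality for [B], since both total masses are
   1. *)
have := limit_preimage_le (measurableC mB).
rewrite preimage_setC !fine_probabilityC//; lra.
Qed.

Lemma continuity_set_preimage (n : nat) (A : set X) :
  continuity_set P A -> continuity_set P (iter n T @^-1` A).
Proof.
have cTn : continuous (iter n T).
  elim: n => [|n IH] x; first exact: cvg_id.
  by apply: continuous_comp; [exact: IH|exact: T_continuous].
move/continuousP : (cTn) => oTn; move/continuous_closedP : (cTn) => clTn.
move=> [mA [U [K [oU cK UA AK KU]]]].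
split; first exact: measurable_iter_preimage.
exists (iter n T @^-1` U), (iter n T @^-1` K); split.
- exact: oTn.
- exact: clTn.
- exact: preimage_subset.
- exact: preimage_subset.
rewrite (_ : _ `\` _ = iter n T @^-1` (K `\` U))// (invariant_measure_iter mT _
  limit_invariant)//.
by apply: measurableD; [exact: closed_borel|exact: open_borel].
Qed.

Lemma continuity_set_itinerary (I : finType) (c : X -> I) (n : nat) (s :
  {ffun 'I_n -> I}) :
  (forall i, continuity_set P (c @^-1` [set i])) ->
  continuity_set P (itinerary T c n @^-1` [set s]).
Proof.
move=> cc; rewrite itinerary_preimage.
have -> : [set: 'I_n] = [set` enum 'I_n].
  by apply/seteqP; split => // k _; rewrite /= mem_enum.
rewrite bigcap_seq; apply: big_ind => [|A B|k _].
- exact: continuity_setT.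
- exact: continuity_setI.
- exact: continuity_set_preimage.
Qed.

Lemma limit_label_entropy (I : finType) (c : X -> I) (n : nat) :
  (forall i, continuity_set P (c @^-1` [set i])) ->
  label_entropy l (itinerary T c n) = label_entropy (fine \o P) (itinerary T c n).
Proof.
move=> cc; apply: eq_shannon => s; apply: limit_continuity_set.
exact: continuity_set_itinerary.
Qed.

End limit_measure.

(** * Integrals of bounded measurable functions *)

Section bounded_integral.
Context {d : measure_display} {Y : measurableType d} {R : realType}.
Variable P : probability Y R.

Definition bounded_measurable (f : Y -> R) : Prop :=
  measurable_fun setT f /\ exists M : R, forall x, `|f x| <= M.

Lemma bounded_measurable_cst (r : R) : bounded_measurable (fun=> r).
Proof. by split; [exact: measurable_cst|exists `|r|]. Qed.

Lemma bounded_measurableD (f g : Y -> R) : bounded_measurable f ->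
  bounded_measurable g -> bounded_measurable (fun x => f x + g x).
Proof.
move=> [mf [M fM]] [mg [N gN]]; split; first exact: measurable_funD.
by exists (M + N) => x; rewrite (le_trans (ler_normD _ _))// lerD.
Qed.

Lemma bounded_measurableZ (r : R) (f : Y -> R) : bounded_measurable f ->
  bounded_measurable (fun x => r * f x).
Proof.
move=> [mf [M fM]]; split; first exact: measurable_funM.
by exists (`|r| * M) => x; rewrite normrM ler_wpM2l.
Qed.

Lemma bounded_measurable_sum (I : Type) (s : seq I) (f : I -> Y -> R) :
  (forall i, bounded_measurable (f i)) ->
  bounded_measurable (fun x => \sum_(i <- s) f i x).
Proof.
move=> bf; elim: s => [|i s IH].
  by under eq_fun do rewrite big_nil; exact: bounded_measurable_cst.
by under eq_fun do rewrite big_cons; exact: bounded_measurableD.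
Qed.

Lemma bounded_measurable_max (f g : Y -> R) : bounded_measurable f ->
  bounded_measurable g -> bounded_measurable (fun x => Num.max (f x) (g x)).
Proof.
move=> [mf [M fM]] [mg [N gN]]; split; first exact: measurable_maxr.
exists (Num.max M N) => x; rewrite le_max.
by rewrite maxEle; case: ifP => _; rewrite ?fM ?gN ?orbT.
Qed.

Lemma bounded_measurable_indic (A : set Y) : measurable A ->
  bounded_measurable (\1_A : Y -> R).
Proof.
move=> mA; split; first exact: measurable_indic.
by exists 1 => x; rewrite indicE; case: (x \in A); rewrite ?normr1 ?normr0.
Qed.

Lemma bounded_measurable_comp (T : Y -> Y) (f : Y -> R) :
  measurable_fun setT T -> bounded_measurable f -> bounded_measurable (f \o T).
Proof.
move=> mT [mf [M fM]]; split; first exact: measurableT_comp.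
by exists M => x; exact: fM.
Qed.

Lemma bounded_measurable_integrable (f : Y -> R) :
  bounded_measurable f -> P.-integrable setT (EFin \o f).
Proof.
move=> [mf [M fM]]; apply: measurable_bounded_integrable => //.
  by rewrite (le_lt_trans (@probability_le1 _ _ _ P setT measurableT))// ltry.
exists M; split; first exact: num_real.
by move=> N MN x _ /=; rewrite (le_trans (fM x))// ltW.
Qed.

Lemma Rintegral_sum (I : Type) (s : seq I) (f : I -> Y -> R) :
  (forall i, bounded_measurable (f i)) ->
  \int[P]_x (\sum_(i <- s) f i x) = \sum_(i <- s) \int[P]_x f i x.
Proof.
move=> bf; elim: s => [|i s IH].
  rewrite big_nil; under [LHS]eq_Rintegral do rewrite big_nil.
  by rewrite Rintegral_cst// mul0r.
rewrite big_cons -IH -RintegralD//.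
- by under [LHS]eq_Rintegral do rewrite big_cons.
- exact: bounded_measurable_integrable.
- by apply: bounded_measurable_integrable; exact: bounded_measurable_sum.
Qed.

Lemma Rintegral_indic (A : set Y) : measurable A ->
  \int[P]_x (\1_A x : R) = fine (P A).
Proof. by move=> mA; rewrite /Rintegral integral_indic// setIT. Qed.

Lemma Rintegral_invariant (T : Y -> Y) (f : Y -> R) :
  measurable_fun setT T -> invariant_measure P T -> bounded_measurable f ->
  \int[P]_x f (T x) = \int[P]_x f x.
Proof.
move=> mT iP bf; rewrite /Rintegral; congr fine.
have mf : measurable_fun setT (EFin \o f) by apply/measurable_EFinP; case: bf.
pose T' : {mfun Y >-> Y} := HB.pack T (isMeasurableFun.Build _ _ _ _ T mT).
have -> : (\int[P]_x (f x)%:E = \int[distribution P T']_x (f x)%:E)%E.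
  by apply: eq_measure_integral => A mA _; apply/esym; exact: iP.
apply/esym; exact: (integral_pushforward mT mf
  (bounded_measurable_integrable (bounded_measurable_comp mT bf)) measurableT).
Qed.

Lemma Rintegral_label (I : finType) (c : Y -> I) (v : I -> R) :
  (forall i, measurable (c @^-1` [set i])) ->
  bounded_measurable (v \o c) /\
  \int[P]_x v (c x) = \sum_i v i * fine (P (c @^-1` [set i])).
Proof.
move=> mc.
have vcE x : v (c x) = \sum_i v i * \1_(c @^-1` [set i]) x.
  rewrite (bigD1 (c x))//= big1 ?addr0 => [|i ic].
    by rewrite indicE mem_set ?mulr1.
  by rewrite indicE memNset ?mulr0// => /esym /eqP; apply/negP.
have bi i : bounded_measurable (fun x => v i * \1_(c @^-1` [set i]) x).
  by apply: bounded_measurableZ; exact: bounded_measurable_indic.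
split.
  rewrite (_ : v \o c = fun x => \sum_i v i * \1_(c @^-1` [set i]) x).
    exact: bounded_measurable_sum.
  by apply/funext => x; rewrite /= vcE.
under [LHS]eq_Rintegral do rewrite vcE.
rewrite Rintegral_sum//; apply: eq_bigr => i _.
rewrite RintegralZl// ?Rintegral_indic//.
by apply: bounded_measurable_integrable; exact: bounded_measurable_indic.
Qed.

Lemma Rintegral_label_approx (I : finType) (c : Y -> I) (v : I -> R)
    (f : Y -> R) (e : R) :
  (forall i, measurable (c @^-1` [set i])) -> bounded_measurable f ->
  (forall x, `|f x - v (c x)| <= e) ->
  `|\int[P]_x f x - \sum_i v i * fine (P (c @^-1` [set i]))| <= e.
Proof.
move=> mc bf fv; have [bvc <-] := Rintegral_label v mc.
have i1 := bounded_measurable_integrable bf.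
have i2 : P.-integrable setT (EFin \o (fun x => v (c x))).
  exact: bounded_measurable_integrable bvc.
rewrite -RintegralB//.
have bB : bounded_measurable (fun x => f x - v (c x)).
  apply: bounded_measurableD => //.
  rewrite (_ : (fun x => - v (c x)) = (fun x => (-1) * (v \o c) x)).
    exact: bounded_measurableZ.
  by apply/funext => x; rewrite mulN1r.
have Icst r : \int[P]_(x in setT) r = r.
  by rewrite Rintegral_cst// [X in fine X](_ : _ = 1%E) ?mulr1//;
    exact: probability_setT.
rewrite ler_norml; apply/andP; split.
  rewrite -[leLHS]Icst.
  apply: le_Rintegral => //; try exact: bounded_measurable_integrable.
    by apply: bounded_measurable_integrable; exact: bounded_measurable_cst.
  by move=> x _; have := fv x; rewrite ler_norml => /andP[].
rewrite -[leRHS]Icst.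
apply: le_Rintegral => //; try exact: bounded_measurable_integrable.
  by apply: bounded_measurable_integrable; exact: bounded_measurable_cst.
by move=> x _; have := fv x; rewrite ler_norml => /andP[].
Qed.

End bounded_integral.

(** * Empirical measures and Misiurewicz's inequality *)

Section empirical.
Context {R : realType} {X : Type}.
Implicit Types (E : seq X) (A : set X).

Definition empirical E A : R := (\sum_(x <- E) \1_A x) / (size E)%:R.

(** The mean of the push-forwards of [empirical E] by the first [n] iterates. *)
Definition orbit_empirical (T : X -> X) E (n : nat) A : R :=
  (\sum_(k < n) empirical E (iter k T @^-1` A)) / n%:R.

Lemma empirical_ge0 E A : 0 <= empirical E A.
Proof. by rewrite divr_ge0// sumr_ge0// => x _; rewrite indicE. Qed.

Lemma empirical_setT E : (0 < size E)%N -> empirical E setT = 1.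
Proof.
move=> E0; rewrite /empirical; under eq_bigr do rewrite indicT/=.
rewrite big_const_seq count_predT iter_addr_0 -[X in X / _]mulr_natl mulr1.
by rewrite divff// pnatr_eq0 -lt0n.
Qed.

Lemma empirical_le1 E A : empirical E A <= 1.
Proof.
have [E0|E0] := posnP (size E); first by rewrite /empirical E0 invr0 mulr0.
rewrite -(empirical_setT E0) ler_wpM2r// ler_sum// => x _.
by rewrite !indicE in_setT ler_nat leq_b1.
Qed.

Lemma empirical_fin_additive E :
  (0 < size E)%N -> fin_additive setT (empirical E).
Proof.
move=> E0; split => //.
- rewrite /empirical big1 ?mul0r// => x _; by rewrite indic0.
- exact: empirical_ge0.
- exact: empirical_setT.
move=> A B _ _ AB; rewrite /empirical -mulrDl -big_split/=; congr (_ / _).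
apply: eq_bigr => x _; rewrite !indicE in_setU.
have [xA|] := boolP (x \in A); have [xB|] := boolP (x \in B) => //=; last first.
- by rewrite addr0.
- by rewrite add0r.
- by rewrite addr0.
by move: xA xB; rewrite !inE => xA xB; have : set0 x by rewrite -AB.
Qed.

Lemma orbit_empirical_ge0 T E n A : 0 <= orbit_empirical T E n A.
Proof. by rewrite divr_ge0// sumr_ge0// => k _; exact: empirical_ge0. Qed.

Lemma orbit_empirical_le1 T E n A : orbit_empirical T E n A <= 1.
Proof.
have [->|n0] := posnP n; first by rewrite /orbit_empirical big_ord0 mul0r.
rewrite ler_pdivrMr ?ltr0n// mul1r -[leRHS](_ : \sum_(k < n) 1 = _); last first.
  by rewrite sumr_const card_ord.
by apply: ler_sum => k _; exact: empirical_le1.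
Qed.

Lemma orbit_empirical_fin_additive T E n : (0 < size E)%N -> (0 < n)%N ->
  fin_additive setT (orbit_empirical T E n).
Proof.
move=> E0 n0; have eA := empirical_fin_additive E0.
split => //.
- rewrite /orbit_empirical big1 ?mul0r// => k _; rewrite preimage_set0.
  exact: fadd0 eA.
- exact: orbit_empirical_ge0.
- rewrite /orbit_empirical (eq_bigr (fun=> 1)) => [|k _].
    by rewrite sumr_const card_ord divff// pnatr_eq0 -lt0n.
  by rewrite preimage_setT; exact: fadd_total eA.
move=> A B _ _ AB; rewrite /orbit_empirical -mulrDl -big_split/=; congr (_ / _).
apply: eq_bigr => k _; rewrite preimage_setU; apply: (faddU eA) => //.
by rewrite -preimage_setI AB preimage_set0.
Qed.

(** The difference telescopes to its two end terms, each in the unit interval. *)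
Lemma orbit_empirical_preimage T E n A :
  `|orbit_empirical T E n (T @^-1` A) - orbit_empirical T E n A| <= n%:R^-1.
Proof.
rewrite /orbit_empirical -mulrBl -sumrB.
rewrite (eq_bigr (fun k : 'I_n => empirical E (iter k.+1 T @^-1` A)
   - empirical E (iter k T @^-1` A))); last first.
  by move=> k _; congr (empirical E _ - _); apply/seteqP; split => x /=;
    rewrite -iterS.
rewrite -(big_mkord xpredT (fun k => empirical E (iter k.+1 T @^-1` A)
   - empirical E (iter k T @^-1` A))) telescope_sumr//.
rewrite normrM [X in _ * X]ger0_norm ?invr_ge0// -[leRHS]mul1r ler_wpM2r
  ?invr_ge0//.
have := empirical_ge0 E (iter n T @^-1` A);
  have := empirical_le1 E (iter n T @^-1` A).
have := empirical_ge0 E (iter 0 T @^-1` A);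
  have := empirical_le1 E (iter 0 T @^-1` A).
by rewrite ler_norml; lra.
Qed.

(** Both sides are the integral of the step function [v \o c] against the orbit measure; the right
    one is the mean over [E] of its time averages. *)
Lemma orbit_empirical_sum T E n (I : finType) (c : X -> I) (v : I -> R) :
  \sum_i v i * orbit_empirical T E n (c @^-1` [set i]) =
  (\sum_(x <- E) (\sum_(k < n) v (c (iter k T x))) / n%:R) / (size E)%:R.
Proof.
have vcE x : v (c x) = \sum_i v i * \1_(c @^-1` [set i]) x.
  rewrite (bigD1 (c x))//= big1 ?addr0 => [|i ic].
    by rewrite indicE mem_set ?mulr1.
  by rewrite indicE memNset ?mulr0// => /esym /eqP; apply/negP.
pose w : R := (size E)%:R^-1 / n%:R.
have -> : (\sum_(x <- E) (\sum_(k < n) v (c (iter k T x))) / n%:R) / (size E)%:R =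
    (\sum_(x <- E) \sum_(k < n) v (c (iter k T x))) * w.
  by rewrite -mulr_suml -mulrA [n%:R^-1 / _]mulrC.
have OE A : orbit_empirical T E n A =
    (\sum_(k < n) \sum_(x <- E) \1_A (iter k T x)) * w.
  by rewrite /orbit_empirical /empirical -mulr_suml -mulrA.
under eq_bigr do rewrite OE mulrA.
rewrite -mulr_suml; congr (_ * _).
under eq_bigr do rewrite mulr_sumr.
rewrite exchange_big/= [RHS]exchange_big/=; apply: eq_bigr => k _.
under eq_bigr do rewrite mulr_sumr.
by rewrite exchange_big/=; apply: eq_bigr => x _; rewrite vcE.
Qed.

End empirical.

Section misiurewicz.
Context {R : realType} {X : choiceType}.
Variables (T : X -> X) (E : seq X).
Hypotheses (E_uniq : uniq E) (E_gt0 : (0 < size E)%N).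

Lemma empirical_entropy_inj (I : finType) (c : X -> I) :
  {in E &, injective c} -> label_entropy (empirical E) c = ln (size E)%:R :> R.
Proof.
move=> cI; have N0 : 0 < (size E)%:R :> R by rewrite ltr0n.
have p1 x : x \in E -> empirical E (c @^-1` [set c x]) = (size E)%:R^-1 :> R.
  move=> xE; rewrite /empirical -[RHS]mul1r; congr (_ / _).
  rewrite (eq_big_seq (fun y => (y == x)%:R)) => [|y yE].
    by rewrite (bigD1_seq x)//= eqxx big1 ?addr0// => y /negbTE ->.
  rewrite indicE; congr (nat_of_bool _)%:R; apply/idP/eqP => [|->];
    rewrite inE//=.
  exact: cI.
rewrite /label_entropy /shannon.
have -> : \sum_i empirical E (c @^-1` [set i]) * ln (empirical E (c @^-1` [set
  i])) =
    \sum_(x <- E) (size E)%:R^-1 * ln (empirical E (c @^-1` [set c x]) : R).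
  transitivity (\sum_i \sum_(x <- E) \1_(c @^-1` [set i]) x / (size E)%:R *
      ln (empirical E (c @^-1` [set i]) : R)).
    by apply: eq_bigr => i _; rewrite -!mulr_suml.
  rewrite exchange_big/=; apply: eq_bigr => x _.
  rewrite (bigD1 (c x))//= big1 ?addr0 => [|i ic].
    by rewrite indicE mem_set ?mul1r.
  by rewrite indicE memNset ?mul0r// => /esym /eqP; apply/negP.
rewrite (eq_big_seq (fun=> (size E)%:R^-1 * - ln (size E)%:R)) => [|x xE].
  rewrite big_const_seq count_predT iter_addr_0 -[X in - X]mulr_natl mulrA.
  by rewrite divff ?mul1r ?opprK// gt_eqF.
by rewrite p1// lnV.
Qed.

(** Injectivity at all lengths [n + j] makes every term of the last window [b n] equal to
    [ln (size E)]. The first window [b 0] is bounded independently of [n], and concavity gathers the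
    [n] increments [H' k] into the entropy of the orbit average. *)
Lemma orbit_empirical_entropy_ge (I : finType) (c : X -> I) (n q : nat) :
  (0 < n)%N -> (forall j, {in E &, injective (itinerary T c (n + j))}) ->
  q%:R * ln (size E)%:R <= \sum_(j < q) ln #|{ffun 'I_j -> I}|%:R
    + n%:R * label_entropy (orbit_empirical T E n) (itinerary T c q) :> R.
Proof.
move=> n0 cI; have eA := @empirical_fin_additive R X E E_gt0.
pose H i := label_entropy (empirical E : _ -> R) (itinerary T c i).
pose H' k := label_entropy (empirical E : _ -> R) (itinerary T c q \o iter k T).
(* b is the sum of H over a window of length q: moving the window by one step
   changes it by H (k + q) - H k, which is at most H' k. *)
pose b k := \sum_(j < q) H (k + j)%N.
have bS k : b k.+1 <= b k + H' k.
  rewrite -lerBlDl -sumrB (eq_bigr (fun j :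
    'I_q => H (k + j.+1)%N - H (k + j)%N)); last first.
    by move=> j _; rewrite addnS addSn.
  rewrite -(big_mkord xpredT (fun j => H (k + j.+1)%N - H (k + j)%N)).
  rewrite (telescope_sumr (fun j => H (k + j)%N))// addn0 lerBlDl.
  exact: (label_entropy_itinerary eA).
have bn k : b k <= b 0%N + \sum_(i < k) H' i.
  elim: k => [|k IH]; first by rewrite big_ord0 addr0.
  by rewrite big_ord_recr/= (le_trans (bS k))// addrA lerD2r.
have -> : q%:R * ln (size E)%:R = b n.
  rewrite /b (eq_bigr (fun=> ln (size E)%:R)) => [|j _].
    by rewrite sumr_const card_ord mulr_natl.
  exact: (empirical_entropy_inj (cI j)).
apply: le_trans (bn n) _; apply: lerD.
  apply: ler_sum => j _; rewrite add0n; exact: (label_entropy_le_ln_card eA).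
apply: (shannon_concave (p :=
  fun k s => empirical E ((itinerary T c q \o iter k T) @^-1` [set s]))) => //.
- by move=> k i; exact: empirical_ge0.
- by move=> k; exact: (fadd_sum1 eA).
Qed.

End misiurewicz.

(** * Limits along an ultrafilter *)

Section ultralimit.
Context {R : realType} (U : set_system nat).
Hypothesis UU : UltraFilter U.

Lemma ultralimit_cvg (u : nat -> R) (a b : R) :
  (forall n, a <= u n <= b) -> cvg (u @ U).
Proof.
move=> uab.
have cab := @segment_compact R a b.
have [|p [_ pU]] := cab (u @ U) _; first by apply: nearW => n /=;
  rewrite in_itv/= uab.
apply/cvg_ex; exists p => V Vp.
have [//|nV] := in_ultra_setVsetC (u @^-1` V) UU.
by have [x [nVx Vx]] := pU (~` V) V nV Vp.
Qed.

Lemma cvg_sumr (I : Type) (s : seq I) (f : I -> nat -> R) (a : I -> R) :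
  (forall i, f i n @[n --> U] --> a i) ->
  \sum_(i <- s) f i n @[n --> U] --> \sum_(i <- s) a i.
Proof.
move=> fa; elim: s => [|i s IH].
  by rewrite big_nil; under eq_fun do rewrite big_nil; exact: cvg_cst.
by rewrite big_cons; under eq_fun do rewrite big_cons; exact: cvgD.
Qed.

Lemma continuous_xlnx (x : R) : 0 <= x -> {for x, continuous (fun y :
  R => y * ln y)}.
Proof.
rewrite le_eqVlt => /predU1P[<-|x0]; last first.
  by apply: cvgM; [exact: cvg_id|exact: continuous_ln].
apply/cvgrPdist_lt => e e0.
suff : \forall y \near (0 : R), `|y * ln y| < e.
  by apply: filterS => y; rewrite /= mul0r sub0r normrN.
have e20 : 0 < (e / 2) ^+ 2 by rewrite exprn_gt0// divr_gt0.
near=> y.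
have ye : `|y| < (e / 2) ^+ 2.
  by near: y; apply/nbhs_ballP; exists ((e / 2) ^+ 2) => //= z;
    rewrite /ball/= sub0r normrN.
have y1 : `|y| < 1.
  by near: y; apply/nbhs_ballP; exists 1 => //= z; rewrite /ball/= sub0r normrN.
have [y0|y0] := leP y 0; first by rewrite ln0// mulr0 normr0.
rewrite (gtr0_norm y0) in ye y1.
(* With [y = s * s] the product is [2 * s * (s * ln s)], and [- ln s < s^-1] bounds its absolute
   value by [2 * s]. *)
pose s := Num.sqrt y; have s0 : 0 < s by rewrite sqrtr_gt0.
have ys : y = s * s by rewrite -expr2 sqr_sqrtr// ltW.
have se : s < e / 2.
  by rewrite -(ltr_pXn2r (n :=
    2))// ?nnegrE ?divr_ge0 ?ltW// -[s ^+ 2]/(s * s) -ys.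
have s1 : s < 1.
  by rewrite -(ltr_pXn2r (n := 2))// ?nnegrE ?ltW// expr1n -[s ^+ 2]/(s * s) -ys.
have lns : - ln s < s^-1.
  by rewrite -lnV// ln_sublinear// invr_gt0.
have lns0 : ln s < 0 by apply: ln_lt0; rewrite s0.
have -> : y * ln y = 2 * s * (s * ln s).
  by rewrite {2}ys lnM ?posrE// ys; ring.
have sln : - (s * ln s) < 1.
  by rewrite -mulrN -ltr_pdivlMl// mulr1.
have sln0 : s * ln s < 0 by rewrite pmulr_rlt0.
rewrite ltr0_norm; last by rewrite pmulr_rlt0// mulr_gt0.
rewrite -mulrN (lt_trans (_ : _ < 2 * s * 1))//; last lra.
by rewrite ltr_pM2l// mulr_gt0.
Unshelve. all: by end_near. Qed.

Lemma ultralimit_shannon (I : finType) (p : nat -> I -> R) (q : I -> R) :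
  (forall i, 0 <= q i) -> (forall i, p n i @[n --> U] --> q i) ->
  shannon (p n) @[n --> U] --> shannon q.
Proof.
move=> q0 pq; apply: cvgN; apply: cvg_sumr => i.
exact: (cvg_comp _ _ (pq i) (continuous_xlnx (q0 i))).
Qed.

End ultralimit.

Lemma cvgr_le_near (R : realType) (U : set_system nat) {UF : ProperFilter U}
    (u : nat -> R) (a b : R) :
  u n @[n --> U] --> a -> (\forall n \near U, u n <= b) -> a <= b.
Proof.
move=> ua ub; rewrite -(cvg_lim (@Rhausdorff R) ua).
by apply: limr_le => //; apply/cvg_ex; exists a.
Qed.

Lemma cvgr_ge_near (R : realType) (U : set_system nat) {UF : ProperFilter U}
    (u : nat -> R) (a b : R) :
  u n @[n --> U] --> a -> (\forall n \near U, b <= u n) -> b <= a.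
Proof.
move=> ua ub; rewrite -(cvg_lim (@Rhausdorff R) ua).
by apply: limr_ge => //; apply/cvg_ex; exists a.
Qed.

Lemma average_dist_le (R : realType) (I : eqType) (s : seq I) (f g :
  I -> R) (r : R) :
  (0 < size s)%N -> {in s, forall x, `|f x - g x| <= r} ->
  `|(\sum_(x <- s) f x) / (size s)%:R - (\sum_(x <- s) g x) / (size s)%:R| <= r.
Proof.
move=> s0 fg; have N0 : 0 < (size s)%:R :> R by rewrite ltr0n.
rewrite -mulrBl -sumrB normrM (gtr0_norm (x := _^-1)) ?invr_gt0//.
rewrite ler_pdivrMr//; apply: le_trans (ler_norm_sum _ _ _) _.
apply: (@le_trans _ _ (\sum_(x <- s) r)).
  by rewrite big_seq [leRHS]big_seq; apply: ler_sum => x /fg.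
by rewrite big_const_seq count_predT iter_addr_0 -[leLHS]mulr_natr.
Qed.

(** * An invariant measure of large entropy from separated sets *)

Section empirical_limit.
Context {R : realType} {X : pointedMetricType R}.
Variables (T : X -> X) (d : nat) (phi : 'I_d -> X -> R).
Hypothesis X_compact : compact [set: X].
Hypothesis T_continuous : continuous T.
Hypothesis phi_continuous : forall i, continuous (phi i).

Lemma bowen_dist_lt (n : nat) (e : R) (x y : X) : 0 < e ->
  (forall k, (k < n)%N -> mdist (iter k T x) (iter k T y) < e) ->
  bowen_dist T n x y < e.
Proof. by move=> e0 H; apply: bigmax_lt => // k _; exact: H. Qed.

Lemma le_bowen_dist (n k : nat) (x y : X) : (k < n)%N ->
  mdist (iter k T x) (iter k T y) <= bowen_dist T n x y.
Proof. by move=> kn; exact: (le_bigmax _ _ (Ordinal kn)). Qed.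

Lemma continuous_bounded_measurable (f : X -> R) : continuous f ->
  bounded_measurable (f : borel X -> R).
Proof.
move=> cf; split; first exact: continuous_borel_real.
have cfX : compact (range f).
  by apply: continuous_compact => //; apply: continuous_subspaceT.
have [M [_ HM]] := compact_bounded cfX.
exists (`|M| + 1) => x; apply: HM; last by exists x.
by rewrite (le_lt_trans (ler_norm M))// ltrDl.
Qed.

Lemma exists_entropy_measure (U : set_system nat) (UU : UltraFilter U)
    (E : nat -> seq X) (eps : R) (a : 'I_d -> R) (h delta : R) :
  \oo `<=` U -> 0 < eps -> 0 < delta ->
  (forall n, uniq (E n)) -> (forall n, (0 < size (E n))%N) ->
  (\forall n \near U, Defs.separated T n eps [set` E n]) ->
  (\forall n \near U, h * n%:R <= ln (size (E n))%:R) ->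
  (\forall n \near U, {in E n, forall x, forall i,
     `|birkhoff_sum T n (phi i) x / n%:R - a i| <= delta}) ->
  exists P : probability (borel X) R,
    [/\ invariant_measure P T, (h%:E <= ks_entropy P T)%E &
        forall i, `|\int[P]_x phi i x - a i| <= 3 * delta].
Proof.
move=> ooU eps0 delta0 Eu E0 Esep Eh Ea.
have n_gt0 : \forall n \near U, (0 < n)%N by apply: ooU; exists 1%N.
pose mn n A := orbit_empirical T (E n) n A : R.
pose l A := lim (mn n A @[n --> U]).
have hl A : mn n A @[n --> U] --> l A.
  apply: (ultralimit_cvg UU (a := 0) (b := 1)) => n.
  by rewrite orbit_empirical_ge0 orbit_empirical_le1.
have lu A (b : R) : mn n A @[n --> U] --> b -> l A = b.
  by move=> /(cvg_lim (@Rhausdorff R)).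
have lA : fin_additive setT l.
  split => //.
  - apply: lu; apply: cvg_near_cst; near=> n.
    have n0 : (0 < n)%N by near: n.
    exact: (fadd0 (orbit_empirical_fin_additive T (E0 n) n0)).
  - move=> A; apply: (cvgr_ge_near (hl A)).
    by apply: nearW => n; exact: orbit_empirical_ge0.
  - apply: lu; apply: cvg_near_cst; near=> n.
    have n0 : (0 < n)%N by near: n.
    exact: (fadd_total (orbit_empirical_fin_additive T (E0 n) n0)).
  move=> A B _ _ AB; apply: lu.
  apply: (cvg_trans _ (cvgD (hl A) (hl B))); apply: near_eq_cvg.
  near=> n; have n0 : (0 < n)%N by near: n.
  by apply/esym; exact: (faddU (orbit_empirical_fin_additive T (E0 n) n0)).
have lT A : l (T @^-1` A) = l A.
  apply/eqP; rewrite -subr_eq0 -normr_le0; apply/ler_addgt0Pr => e e0.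
  rewrite add0r.
  apply: (cvgr_le_near (cvg_norm (cvgB (hl (T @^-1` A)) (hl A)))); near=> n.
  apply: le_trans (orbit_empirical_preimage _ _ _ _) _.
  near: n; apply: ooU; near=> n.
  have n0 : (0 < n)%N by near: n; exists 1%N.
  rewrite -[leLHS]mul1r ler_pdivrMr ?ltr0n// -ler_pdivrMl// mulr1.
  by near: n; exact: nbhs_infty_ger.
have [P PU] := exists_regular_probability lA (compact_normal (@metric_hausdorff
  R X) X_compact) X_compact.
have mT : measurable_fun setT (T : borel X -> borel X) :=
  continuous_borel T_continuous.
have iP : invariant_measure P T by exact: (limit_invariant X_compact
  T_continuous lA lT PU).
(* Cells of diameter below [eps] give distinct itineraries to [eps]-separated points; oscillation
   below [delta] lets each [phi i] be replaced by a step function. *)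
have me0 : 0 < Num.min eps delta by rewrite lt_min eps0.
have [m [c [cc cdist]]] :=
  exists_continuity_partition P X_compact phi_continuous me0.
have mc i : measurable (c @^-1` [set i] : set (borel X)) by case: (cc i).
have Einj : \forall n \near U, forall j, {in E n &, injective (itinerary T c (n
  + j))}.
  move: Esep; apply: filterS => n sep j x y xE yE /ffunP cxy.
  apply: contrapT => /(sep _ _ xE yE); apply/negP; rewrite -leNgt ltW//.
  apply: bowen_dist_lt => // k kn; have := cxy (lshift j (Ordinal kn)).
  rewrite !ffunE/= => /cdist[+ _] => /lt_le_trans; apply.
  by rewrite ge_min lexx.
exists P; split => //.
(* Misiurewicz's estimate divided by [n]: the entropy at fixed length [q] passes to the limit along
   [U], and the term [C], independent of [n], disappears. *)
- have hq q : (0 < q)%N -> h * q%:R <= label_entropy (fine \o P) (itinerary T c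
  q).
    move=> q0; rewrite -(limit_label_entropy X_compact T_continuous lA lT PU)//.
    pose C : R := \sum_(j < q) ln #|{ffun 'I_j -> 'I_m}|%:R.
    have := ultralimit_shannon UU (p :=
      fun n s => mn n (itinerary T c q @^-1` [set s]))
      (fun s => fadd_ge0 lA _) (fun s => hl _).
    move=> Hc; apply/ler_addgt0Pr => e e0.
    apply: (cvgr_ge_near (cvgD Hc (cvg_cst e))); near=> n.
    have n0 : (0 < n)%N by near: n.
    have N0 : 0 < n%:R :> R by rewrite ltr0n.
    have inj : forall j, {in E n &, injective (itinerary T c (n + j))} by near: n.
    have := @orbit_empirical_entropy_ge R X T (E n) (Eu n) (E0 n) _ c n q n0 inj.
    have hn : h * n%:R <= ln (size (E n))%:R by near: n.
    have Ce : C <= e * n%:R.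
      rewrite -ler_pdivrMl// mulrC; near: n; apply: ooU; exact: nbhs_infty_ger.
    rewrite -/C; set L := label_entropy _ _.
    move=> HL; change (h * q%:R <= L + e).
    rewrite -(ler_pM2r N0).
    have : q%:R * (h * n%:R) <= q%:R * ln (size (E n))%:R by rewrite ler_wpM2l.
    move: HL Ce; rewrite mulrDl; lra.
  have Pc := partition_entropy_label_cvg mT mc iP.
  apply: (@le_trans _ _ (partition_entropy P T (fun i => c @^-1` [set i]))%:E).
    rewrite lee_fin; apply: (cvgr_ge_near Pc).
    exists 1%N => // n /= n0; rewrite ler_pdivlMr ?ltr0n//; exact: hq.
  apply: ereal_sup_ubound; exists m, (fun i => c @^-1` [set i]); split => //.
  exact: finite_partition_label.
move=> i.
pose v j := phi i (xget point (c @^-1` [set j])).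
have vc x : `|phi i x - v (c x)| <= delta.
  have /cdist[_ /(_ i)] : c x = c (xget point (c @^-1` [set c x])).
    by have := xgetI (P := c @^-1` [set c x]) point (erefl (c x)) => ->.
  by move=> /ltW/le_trans; apply; rewrite ge_min lexx orbT.
have H1 := Rintegral_label_approx P mc (continuous_bounded_measurable
  (phi_continuous (i := i))) vc.
(* On the cells [P] equals [l], a limit of orbit measures. One [delta] pays for the step function
   along orbits, one for the hypothesis on [E n]; the third is the step function under [P] in
   [H1]. *)
have H2 : `|\sum_j v j * fine (P (c @^-1` [set j])) - a i| <= 2 * delta.
  have -> : \sum_j v j * fine (P (c @^-1` [set j])) = \sum_j v j * l (c @^-1`
    [set j]).
    apply: eq_bigr => j _; congr (_ * _); apply/esym.
    exact: (limit_continuity_set lA PU (cc j)).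
  have vl : \sum_j v j * mn n (c @^-1` [set j]) @[n --> U] --> \sum_j v j * l
    (c @^-1` [set j]).
    by apply: (cvg_sumr UU) => j; apply: cvgM; [exact: cvg_cst|exact: hl].
  apply: (cvgr_le_near (cvg_norm (cvgB vl (cvg_cst (a i))))); near=> n.
  have n0 : (0 < n)%N by near: n.
  have Ean : {in E n, forall x, forall i, `|birkhoff_sum T n (phi i) x / n%:R -
    a i| <= delta}.
    by near: n.
  change (`|\sum_j v j * orbit_empirical T (E n) n (c @^-1` [set j]) - a i| <=
    2 * delta).
  rewrite orbit_empirical_sum.
  have -> : a i = (\sum_(x <- E n) a i) / (size (E n))%:R.
    rewrite big_const_seq count_predT iter_addr_0 -[X in X / _]mulr_natr mulfK//.
    by rewrite pnatr_eq0 -lt0n.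
  apply: average_dist_le => // x xE.
  have := Ean x xE i.
  have : `|(\sum_(k < n) v (c (iter k T x))) / n%:R - birkhoff_sum T n (phi i)
    x / n%:R| <= delta.
    have := @average_dist_le R _ (enum 'I_n) (fun k => v (c (iter k T x)))
      (fun k : 'I_n => phi i (iter k T x)) delta.
    rewrite size_enum_ord !big_enum/=; apply => // k _.
    by rewrite distrC; exact: vc.
  by rewrite !ler_norml; lra.
have := ler_distD (\sum_j v j * fine (P (c @^-1` [set j]))) (\int[P]_x phi i x)
  (a i).
lra.
Unshelve. all: by end_near. Qed.

End empirical_limit.

(** * The upper bound *)

Lemma lee_of_lt_fin (R : realType) (x y : \bar R) :
  (forall c : R, (c%:E < x -> c%:E <= y)%E) -> (x <= y)%E.
Proof.
case: x => [r| |] H; last by rewrite leNye.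
- apply/lee_addgt0Pr => e e0; rewrite -leeBlDr// -EFinB; apply: H.
  by rewrite lte_fin ltrBlDr ltrDl.
by rewrite leye_eq; apply/eqP/eqyP => A _; apply: H; rewrite ltry.
Qed.

Lemma frequently_mem (I : eqType) (s : seq I) (Q : I -> nat -> Prop) :
  (forall N, exists2 n, (N <= n)%N & exists2 v, v \in s & Q v n) ->
  exists2 v, v \in s & forall N, exists2 n, (N <= n)%N & Q v n.
Proof.
elim: s => [|v s IH] H; first by have [n _ []] := H 0%N.
have [Hv|/existsNP[N0 HN0]] := pselect (forall N, exists2 n, (N <= n)%N & Q v n).
  by exists v => //; rewrite mem_head.
have [|w ws Hw] := IH.
  move=> N; have [n] := H (maxn N0 N); rewrite geq_max => /andP[N0n Nn].
  move=> [w]; rewrite inE => /predU1P[->|ws] Qwn.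
    by exfalso; apply: HN0; exists n.
  by exists n => //; exists w.
by exists w => //; rewrite inE ws orbT.
Qed.

(** Replaces the extraction of a subsequence: [G] is unbounded, so the trace of [\oo] on it is a
    proper filter and extends to an ultrafilter. *)
Lemma frequently_ultrafilter (G : set nat) :
  (forall N, exists2 n, (N <= n)%N & G n) ->
  exists U : set_system nat, [/\ UltraFilter U, \oo `<=` U & U G].
Proof.
move=> HG.
have PF : ProperFilter (within G \oo).
  split; last exact: within_filter.
  by move=> [N _ HN]; have [n Nn Gn] := HG N; exact: (HN n Nn Gn).
have [U [UU WU]] := ultraFilterLemma PF.
exists U; split => //.
- by move=> A ooA; apply: WU; apply: filterS ooA => n An _.
- by apply: WU; exists 0%N.
Qed.

(** The cells may overlap, which only enlarges the double sum. *)
Lemma filter_pigeonhole (R : realType) (I J : eqType) (E : seq I) (s : seq J)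
    (cell : J -> pred I) (w : I -> R) (r : R) :
  (forall x, 0 <= w x) -> {in E, forall x, exists2 v, v \in s & cell v x} ->
  0 <= r -> r < \sum_(x <- E) w x ->
  exists2 v, v \in s & r < (size s)%:R * \sum_(x <- E | cell v x) w x.
Proof.
move=> w0 Es r0 rw; apply: contrapT => H.
have {}H v : v \in s -> (size s)%:R * \sum_(x <- E | cell v x) w x <= r.
  by move=> vs; rewrite leNgt; apply/negP => lt; apply: H; exists v.
have : \sum_(x <- E) w x <= \sum_(v <- s) \sum_(x <- E | cell v x) w x.
  rewrite (exchange_big_dep predT)//= big_seq [leRHS]big_seq;
    apply: ler_sum => x /Es[v vs vx].
  rewrite (big_rem v)//= vx -[leLHS]addr0 lerD2l; exact: sumr_ge0.
have [s0|s0] := posnP (size s).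
  by move/size0nil : s0 => ->; rewrite big_nil; lra.
have N0 : 0 < (size s)%:R :> R by rewrite ltr0n.
have : \sum_(v <- s) \sum_(x <- E | cell v x) w x <= \sum_(v <- s) r / (size
  s)%:R.
  by rewrite big_seq [leRHS]big_seq; apply: ler_sum => v vs;
    rewrite ler_pdivlMr// mulrC H.
rewrite [leRHS]big_const_seq count_predT iter_addr_0 -[leRHS]mulr_natr divfK
  ?gt_eqF//.
lra.
Qed.

Section upper_bound.
Context {R : realType} {X : pointedMetricType R}.
Variables (T : X -> X) (d : nat) (phi : 'I_d -> X -> R) (F : 'rV[R]_d -> R).
Hypothesis X_compact : compact [set: X].
Hypothesis T_continuous : continuous T.
Hypothesis phi_continuous : forall i, continuous (phi i).
Hypothesis F_continuous : continuous F.

Definition birkhoff_average (n : nat) (x : X) : 'rV[R]_d :=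
  \row_i (birkhoff_sum T n (phi i) x / n%:R).

Definition weight (n : nat) (x : X) : R := expR (n%:R * F (birkhoff_average n x)).

Definition pressure_rate (e : R) : \bar R :=
  limn_esup (fun n => (n%:R^-1)%:E * lne (separated_sup T phi F n e))%E.

(** A separated set may be infinite, but its sum is a supremum over finite subsets, and these are
    again separated. *)
Lemma frequently_separated (c e : R) : (c%:E < pressure_rate e)%E ->
  forall N, exists2 n, (N <= n)%N & exists E : seq X,
    [/\ (0 < n)%N, uniq E, Defs.separated T n e [set` E] &
        expR (c * n%:R) < \sum_(x <- E) weight n x].
Proof.
move=> ce N.
(* The tail starts at [N.+1] so that [n] is positive. *)
have : (c%:E < ereal_sup ((fun n => (n%:R^-1)%:E * lne (separated_sup T phi F n
  e))%E
    @` [set n | (N.+1 <= n)%N]))%E.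
  apply: lt_le_trans ce _; apply: ereal_inf_lbound.
  by exists [set n | (N.+1 <= n)%N] => //; exists N.+1.
move=> /ereal_sup_gt[_ [n /= Nn <-]] cn.
exists n; first exact: ltnW.
have n0 : (0 < n)%N by apply: leq_ltn_trans Nn.
have : ((expR (c * n%:R))%:E < separated_sup T phi F n e)%E.
  rewrite ltNge; apply/negP => le; move: cn; apply/negP; rewrite -leNgt.
  have N0 : 0 < n%:R :> R by rewrite ltr0n.
  rewrite muleC lee_pdivrMr// -EFinM.
  have [s0|s0] := leP (separated_sup T phi F n e) 0%E;
    first by rewrite le0_lneNy// leNye.
  move: le s0; case: separated_sup => [r| |]//; rewrite !lee_fin lte_fin => re r0.
  by rewrite lne_EFin// lee_fin -[leRHS]expRK ler_ln// posrE expR_gt0.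
move=> /ereal_sup_gt[_ [E sepE <-]] /ereal_sup_gt[_ [A [finA AE] <-]] lt.
exists (finmap.enum_fset (fset_set A)); split => //.
- exact: finmap.fset_uniq.
- have AEq : [set` finmap.enum_fset (fset_set A)] = A by exact: fset_setK.
  by rewrite AEq => x y /AE Ex /AE Ey; exact: sepE.
- by rewrite -lte_fin -sumEFin -fsbig_finite.
Qed.

(** All averages lie in one compact box, so [s] serves every [n] and [x]. The radius depends on the
    centre because it comes from continuity of [F] at that point. *)
Lemma birkhoff_average_cover (r : 'rV[R]_d -> R) : (forall v, 0 < r v) ->
  exists s : seq 'rV[R]_d, forall n x, (0 < n)%N ->
    exists2 v, v \in s & ball v (r v) (birkhoff_average n x).
Proof.
move=> r0.
have /choice[M HM] i : exists M : R, forall x, `|phi i x| <= M.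
  by have [] := continuous_bounded_measurable X_compact (phi_continuous (i := i)).
have cK := @rV_compact R d (fun i => `[- M i, M i]%classic) (fun i =>
  @segment_compact R _ _).
set K := [set v | _] in cK.
have KB : K `<=` cover setT (fun v => (ball v (r v))°).
  by move=> v _; exists v => //; exact: nbhsx_ballx.
move: cK; rewrite compact_cover => /(_ _ setT (fun v => (ball v (r v))°)).
move=> /(_ (fun v _ => @open_interior _ _) KB)[D _ DK].
exists (finmap.enum_fset D) => n x n0.
have [|v vD vx] := DK (birkhoff_average n x).
  move=> i /=; rewrite mxE in_itv/= -ler_norml normrM [X in _ * X]ger0_norm
    ?invr_ge0//.
  rewrite ler_pdivrMr ?ltr0n//; apply: le_trans (ler_norm_sum _ _ _) _.
  apply: (@le_trans _ _ (\sum_(k < n) M i)); first by apply: ler_sum => k _;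
    exact: HM.
  by rewrite sumr_const card_ord mulr_natr.
by exists v => //; exact: interior_subset vx.
Qed.

Let S := ereal_sup [set (ks_entropy mu T + (F (\row_i \int[mu]_x phi i x))%:E)%E
    | mu in invariant_borel_measures T].

Lemma pressure_rate_le (eps : R) : 0 < eps -> (pressure_rate eps <= S)%E.
Proof.
move=> eps0; apply: lee_of_lt_fin => c cL; apply/lee_addgt0Pr => e' e'0.
(* One third absorbs the number of cells, one the variation of [F] over the cell, one the passage
   from [F v] to [F] of the integrals. *)
pose e := e' / 3; have e0 : 0 < e by rewrite divr_gt0.
have /choice[rho Hrho] (v : 'rV[R]_d) : exists rho : R, 0 < rho /\
    forall u, ball v rho u -> `|F v - F u| < e.
  have /cvgrPdist_lt/(_ _ e0)/nbhs_ballP[rho /= rho0 Hr] := F_continuous (x := v).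
  by exists rho; split.
have rho0 v : 0 < rho v by case: (Hrho v).
(* The limit measure has integrals within [3 * delta v] of [v], which must stay below [rho v]. *)
pose delta v := rho v / 4; have delta0 v : 0 < delta v by rewrite divr_gt0.
have [s Hs] := birkhoff_average_cover delta0.
pose Q v n := exists E :
  seq X, [/\ (0 < n)%N, uniq E, Defs.separated T n eps [set` E],
  expR (c * n%:R) < (size s)%:R * \sum_(x <- E) weight n x &
  {in E, forall x, ball v (delta v) (birkhoff_average n x)}].
have [|v vs Qv] := @frequently_mem _ s Q.
  move=> N; have [n Nn [E [n0 uE sE cE]]] := frequently_separated cL N.
  exists n => //.
  have [||||v vs Hv] := @filter_pigeonhole R _ _ E s
    (fun v x => `[< ball v (delta v) (birkhoff_average n x) >]) (weight n)
      (expR (c * n%:R)).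
  - by move=> x; exact: expR_ge0.
  - by move=> x _; have [v vs vx] := Hs n x n0; exists v => //; apply/asboolP.
  - exact: expR_ge0.
  - exact: cE.
  exists v => //; exists [seq x <- E | `[< ball v (delta v) (birkhoff_average n
    x) >]]; split => //.
  - exact: filter_uniq.
  - move=> x y; rewrite /= !mem_filter => /andP[_ xE] /andP[_ yE]; exact: sE.
  - by rewrite big_filter.
  - by move=> x; rewrite mem_filter => /andP[/asboolP].
have [U [UU ooU UQ]] := frequently_ultrafilter Qv.
(* Where [Q v n] fails, on a set outside [U], a one-point list serves as default, since the lists
   must be duplicate-free and nonempty for every [n]. *)
have /choice[E HE] n : exists E : seq X, uniq E /\ (0 < size E)%N /\ (Q v n ->
    [/\ (0 < n)%N, uniq E, Defs.separated T n eps [set` E],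
  expR (c * n%:R) < (size s)%:R * \sum_(x <- E) weight n x &
  {in E, forall x, ball v (delta v) (birkhoff_average n x)}]).
  have [[E HE]|nQ] := pselect (Q v n); last by exists [:: point]; split.
  exists E; split; [by case: HE|split => //].
  case: HE => _ _ _ + _; case: E => //; rewrite big_nil mulr0.
  by rewrite ltNge expR_ge0.
have [|||P [iP hP aP]] :=
  @exists_entropy_measure R X T d phi X_compact T_continuous phi_continuous
  U UU E eps (v ord0) (c - F v - 2 * e) (delta v) ooU eps0 (delta0 v)
  (fun n => (HE n).1) (fun n => (HE n).2.1).
- by apply: filterS UQ => n /(HE n).2.2[].
- near=> n.
  have Qn : Q v n by near: n.
  have [n0 uE sE cE aE] := (HE n).2.2 Qn.
  have N0 : 0 < n%:R :> R by rewrite ltr0n.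
  have E0 : 0 < (size (E n))%:R :> R by rewrite ltr0n; exact: (HE n).2.1.
  have s0 : 0 < (size s)%:R :> R by rewrite ltr0n; case: (s) vs.
  have lns : ln (size s)%:R <= e * n%:R.
    rewrite -ler_pdivrMl// mulrC; near: n; apply: ooU; exact: nbhs_infty_ger.
  have : expR (c * n%:R) < (size s)%:R * ((size (E n))%:R * expR (n%:R * (F v +
    e))).
    apply: lt_le_trans cE _; rewrite ler_pM2l//.
    apply: (@le_trans _ _ (\sum_(x <- E n) expR (n%:R * (F v + e)))).
      rewrite big_seq [leRHS]big_seq; apply: ler_sum => x /aE vx.
      rewrite ler_expR ler_pM2l//.
      have /(Hrho v).2 : ball v (rho v) (birkhoff_average n x).
        by apply: le_ball vx; rewrite /delta; have := rho0 v; lra.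
      rewrite ltr_norml; lra.
    by rewrite big_const_seq count_predT iter_addr_0 -[leLHS]mulr_natl.
  rewrite -ltr_ln ?posrE ?mulr_gt0 ?expR_gt0// expRK.
  rewrite lnM ?posrE ?mulr_gt0 ?expR_gt0// lnM ?posrE ?expR_gt0// expRK.
  rewrite [n%:R * _]mulrC; nra.
- near=> n => x xE i.
  have Qn : Q v n by near: n.
  have [n0 uE sE cE aE] := (HE n).2.2 Qn.
  have [_ /(_ ord0 i)] := aE _ xE.
  by rewrite /ball/= mxE distrC => /ltW.
have ballP : ball v (rho v) (\row_i \int[P]_x phi i x).
  split; first exact: rho0.
  move=> i j; rewrite (ord1 i) /ball/= mxE distrC (le_lt_trans (aP j))// /delta.
  by have := rho0 v; lra.
have := (Hrho v).2 _ ballP; rewrite ltr_norml => /andP[_ Fv].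
have PS : (ks_entropy P T + (F (\row_i \int[P]_x phi i x))%:E <= S)%E.
  by apply: ereal_sup_ubound; exists P.
have : ((c - F v - 2 * e)%:E + (F v - e)%:E <= S)%E.
  apply: le_trans PS; apply: leeD => //; rewrite lee_fin; lra.
move=> /(leeD2r e'%:E); apply: le_trans.
rewrite -!EFinD lee_fin /e; lra.
Unshelve. all: by end_near. Qed.

End upper_bound.

(** * An ergodic theorem *)

Section ergodic_averages.
Context {d : measure_display} {Y : measurableType d} {R : realType}.
Variables (P : probability Y R) (T : Y -> Y).
Hypothesis mT : measurable_fun setT T.
Hypothesis eP : ergodic_measure P T.

(* The maximum of the Birkhoff sums of g of order at most n, the empty sum
   included. *)
Fixpoint max_sum (g : Y -> R) (n : nat) (x : Y) : R :=
  if n is n'.+1 then Num.max 0 (g x + max_sum g n' (T x)) else 0.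

Lemma max_sum_ge0 g n x : 0 <= max_sum g n x.
Proof. by case: n => [//|n]; rewrite /= le_max lexx. Qed.

Lemma max_sumS g n x : max_sum g n x <= max_sum g n.+1 x.
Proof.
elim: n x => [|n IH] x; first exact: max_sum_ge0.
by rewrite [leRHS]/= /= ge_max !le_max lexx/= lerD2l IH orbT.
Qed.

Lemma max_sum_mono g m n x : (m <= n)%N -> max_sum g m x <= max_sum g n x.
Proof.
move=> /subnK <-; elim: (n - m)%N => [//|k IH].
exact: le_trans IH (max_sumS _ _ _).
Qed.

Lemma sum_le_max_sum g n x : \sum_(k < n) g (iter k T x) <= max_sum g n x.
Proof.
elim: n x => [|n IH] x; first by rewrite big_ord0.
rewrite big_ord_recl /= le_max lerD2l; apply/orP; right.
rewrite (eq_bigr (fun k : 'I_n => g (iter k T (T x)))); first exact: IH.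
by move=> k _; rewrite -iterSr.
Qed.

Lemma bounded_measurable_max_sum g n : bounded_measurable g ->
  bounded_measurable (max_sum g n).
Proof.
move=> bg; elim: n => [|n IH]; first exact: bounded_measurable_cst.
apply: (@bounded_measurable_max _ _ _ (fun=> 0));
  first exact: bounded_measurable_cst.
exact: bounded_measurableD bg (bounded_measurable_comp mT IH).
Qed.

Let unbounded g := [set x | forall K : nat, exists n, K%:R < max_sum g n x].

Let measurable_level g n r : bounded_measurable g ->
  measurable [set x | r < max_sum g n x].
Proof.
move=> /(@bounded_measurable_max_sum g n)[mM _].
rewrite (_ : [set _ | _] = max_sum g n @^-1` `]r, +oo[).
  by rewrite -[X in measurable X]setTI; apply: mM.
by apply/seteqP; split => x /=; rewrite in_itv/= andbT.
Qed.

Let measurable_unbounded g : bounded_measurable g -> measurable (unbounded g).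
Proof.
move=> bg; rewrite (_ : unbounded g =
    \bigcap_(K : nat) \bigcup_n [set x | K%:R < max_sum g n x]).
  by apply: bigcapT_measurable => K; apply: bigcupT_measurable => n;
    exact: measurable_level.
apply/seteqP; split => x /= H K; first by move=> _; have [n Hn] := H K; exists n.
by have [n _ Hn] := H K I; exists n.
Qed.

(** Passing from [x] to [T x] changes the maximal sums by at most the bound [C] of [g], which does
    not affect unboundedness. The invariance is exact, as [ergodic_measure] requires. *)
Let unbounded_invariant g :
  bounded_measurable g -> T @^-1` (unbounded g) = unbounded g.
Proof.
move=> [_ [M gM]]; pose C := (Num.truncn `|M|).+1.
have gC x : `|g x| <= C%:R.
  rewrite (le_trans (gM x))// (le_trans (ler_norm M))// ltW//.
  by rewrite /C real_truncnS_gt ?num_real.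
apply/seteqP; split => x /= H K.
  have [n] := H (K + C)%N; rewrite natrD => Hn; exists n.+1.
  by rewrite /= lt_max; apply/orP; right; have := gC x; rewrite ler_norml; lra.
have [[|n]] := H (K + C)%N; rewrite natrD /=.
  by rewrite ltNge addr_ge0.
rewrite lt_max => /orP[|Hn]; first by rewrite ltNge addr_ge0.
by exists n; have := gC x; rewrite ler_norml; lra.
Qed.

(* Integrating max_sum g n.+1 - max_sum g n \o T, which is nonnegative on
   average and equals g as soon as max_sum g n \o T is large. *)
Let unbounded_null g : bounded_measurable g -> \int[P]_x g x < 0 ->
  fine (P (unbounded g)) = 0.
Proof.
move=> bg g0; have mB := measurable_unbounded bg.
have [|PB] := eP.2 _ mB (unbounded_invariant bg); first by move=> ->.
exfalso; have [mg [C0 gC0]] := bg.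
pose C : R := `|C0| + 1; have C1 : 0 < C by rewrite ltr_wpDl.
have gC x : `|g x| <= C.
  by rewrite (le_trans (gC0 x))// (le_trans (ler_norm C0))// /C lerDl.
pose low n := [set x | max_sum g n x < C].
have mlow n : measurable (low n).
  have [mM _] := @bounded_measurable_max_sum g n bg.
  rewrite (_ : low n = max_sum g n @^-1` `]-oo, C[).
    by rewrite -[X in measurable X]setTI; apply: mM.
  by apply/seteqP; split => x /=; rewrite in_itv.
have mTlow n : measurable (T @^-1` low n).
  by rewrite -[X in measurable X]setTI; exact: mT.
have key n : - (\int[P]_x g x) <= C * fine (P (low n)).
  have bM k := @bounded_measurable_max_sum g k bg.
  have iM k := bounded_measurable_integrable P (bM k).
  have bMT := bounded_measurable_comp mT (bM n).
  have bI := @bounded_measurable_indic _ _ R _ (mTlow n).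
  have bR : bounded_measurable (fun x => max_sum g n (T x) + (g x + C * \1_(T
    @^-1` low n) x)).
    by apply: bounded_measurableD => //; apply: bounded_measurableD => //;
      exact: bounded_measurableZ.
  have : \int[P]_x max_sum g n.+1 x <=
      \int[P]_x (max_sum g n (T x) + (g x + C * \1_(T @^-1` low n) x)).
    apply: le_Rintegral => //; first exact: bounded_measurable_integrable bR.
    move=> x _; rewrite [leLHS]/=.
    have M0 := max_sum_ge0 g n (T x); have := gC x;
      rewrite ler_norml indicE => gCx.
    rewrite ge_max; case: (boolP (x \in T @^-1` low n)) => xl.
      by rewrite mulr1; apply/andP; split; lra.
    rewrite mulr0; move: xl; rewrite notin_setE /low/= => /negP;
      rewrite -leNgt => MC.
    by apply/andP; split; lra.
  rewrite RintegralD//; last 2 first.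
  - exact: bounded_measurable_integrable bMT.
  - apply: bounded_measurable_integrable; apply: bounded_measurableD => //.
    exact: bounded_measurableZ.
  rewrite RintegralD//; last 2 first.
  - exact: bounded_measurable_integrable.
  - by apply: bounded_measurable_integrable; exact: bounded_measurableZ.
  rewrite RintegralZl//; last exact: bounded_measurable_integrable.
  rewrite Rintegral_indic// (eP.1 _ (mlow n)) (Rintegral_invariant mT eP.1 (bM
    n)).
  have : \int[P]_x max_sum g n x <= \int[P]_x max_sum g n.+1 x.
    by apply: le_Rintegral => // x _; exact: max_sumS.
  lra.
(* If [unbounded g] had full mass, the measure of [low n] would tend to 0, against the positive
   lower bound in [key]. *)
pose G n := low n `&` unbounded g.
have mG n : measurable (G n) by apply: measurableI.
have e0 : 0 < - (\int[P]_x g x) / C by rewrite divr_gt0// oppr_gt0.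
have : \forall n \near \oo, fine (P (G n)) < - (\int[P]_x g x) / C.
  apply: (@fine_probability_bigcup_cvg0 _ _ _ P G) => //.
  - move=> m n mn; apply/subsetPset => x [lx Bx]; split => //.
    by apply: le_lt_trans lx; exact: max_sum_mono.
  - rewrite -subset0 => x Gx; have [_ Bx] := Gx 0%N I.
    have [n Hn] := Bx (Num.truncn C).+1.
    have [lx _] := Gx n I; have := lt_trans Hn lx.
    by apply/negP; rewrite -leNgt ltW// real_truncnS_gt ?num_real.
move=> [n _ /(_ n (leqnn n))/=]; rewrite ltr_pdivlMr// mulrC.
have : fine (P (low n)) <= fine (P (G n)) + fine (P (~` unbounded g)).
  apply: le_trans (fine_probability_leU P (mG n) (measurableC mB)).
  apply: fine_probability_le => //;
    first exact: measurableU (mG n) (measurableC mB).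
  by move=> x lx; have [Bx|nBx] := pselect (unbounded g x); [left|right].
rewrite fine_probabilityC// PB/= subrr addr0 -(ler_pM2l C1).
by have := key n; lra.
Qed.

(** With [b] halfway between the mean of [f] and [a], the function [f - b] has negative mean, so its
    sums are almost surely bounded above. Off a set of measure below [e] a single [K] bounds them,
    and [K <= (a - b) * n] for large [n]. *)
Lemma ergodic_average_gt (f : Y -> R) (a e : R) :
  bounded_measurable f -> \int[P]_x f x < a -> 0 < e ->
  \forall n \near \oo,
    measurable [set x | a * n%:R < \sum_(k < n) f (iter k T x)] /\
    fine (P [set x | a * n%:R < \sum_(k < n) f (iter k T x)]) < e.
Proof.
move=> bf fa e0; pose b := (\int[P]_x f x + a) / 2.
pose g x := f x + - b.
have bg : bounded_measurable g by apply: bounded_measurableD => //;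
  exact: bounded_measurable_cst.
have Ig : \int[P]_x g x < 0.
  rewrite /g RintegralD//; last 2 first.
  - exact: bounded_measurable_integrable.
  - by apply: bounded_measurable_integrable; exact: bounded_measurable_cst.
  have PT : fine (P setT) = 1 by exact: (fadd_total (probability_fin_additive P)).
  by rewrite Rintegral_cst// PT /b; lra.
have B0 := unbounded_null bg Ig; have mB := measurable_unbounded bg.
pose H (K : nat) := \bigcup_n [set x | K%:R < max_sum g n x].
have mH K : measurable (H K) by apply: bigcupT_measurable => n;
  exact: measurable_level.
have : \forall K \near \oo, fine (P (H K `\` unbounded g)) < e.
  apply: (@fine_probability_bigcup_cvg0 _ _ _ P (fun K => H K `\` unbounded g))
    => //.
  - by move=> K; exact: measurableD.
  - move=> m n mn; apply/subsetPset; apply: setSD => x [k _ /= Hk];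
    exists k => //=.
    by apply: le_lt_trans Hk; rewrite ler_nat.
  - rewrite -subset0 => x Hx; have [_] := Hx 0%N I; apply => K.
    by have [[n _ Hn] _] := Hx K I; exists n.
move=> [K _ /(_ K (leqnn K))/= HK].
have ab : 0 < a - b by rewrite /b; lra.
have mS n : measurable [set x | a * n%:R < \sum_(k < n) f (iter k T x)].
  have mf k : measurable_fun setT (fun x => f (iter k T x)).
    apply: measurableT_comp; first by case: bf.
    by elim: k => [|k IH]; [exact: measurable_id|exact: measurableT_comp].
  have ms := @measurable_sum _ _ _ setT _ (index_enum 'I_n) (fun (k :
    'I_n) x => f (iter k T x)) (fun k => mf k).
  rewrite (_ : [set _ | _] = (fun x => \sum_(k < n) f (iter k T x)) @^-1` `]a *
    n%:R, +oo[).
    by rewrite -[X in measurable X]setTI; apply: ms.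
  by apply/seteqP; split => x /=; rewrite in_itv/= andbT.
near=> n; split=> //.
have Kn : K%:R <= (a - b) * n%:R.
  by rewrite -ler_pdivrMl// mulrC; near: n; exact: nbhs_infty_ger.
apply: (@le_lt_trans _ _ (fine (P (H K)))).
  apply: fine_probability_le => // x /= Sx; exists n => //=.
  apply: lt_le_trans (sum_le_max_sum _ _ _).
  rewrite /g big_split/= sumr_const card_ord mulNrn -[b *+ n]mulr_natr; lra.
have : fine (P (H K)) <= fine (P (H K `\` unbounded g)) + fine (P (unbounded g)).
  apply: le_trans (fine_probability_leU P (measurableD (mH K) mB) mB).
  apply: fine_probability_le => //;
    first exact: measurableU (measurableD (mH K) mB) mB.
  by move=> x Hx; have [Bx|nBx] := pselect (unbounded g x); [right|left].
by rewrite B0 addr0 => /le_lt_trans; apply.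
Unshelve. all: by end_near. Qed.

End ergodic_averages.

(** * The lower bound *)

Section lower_tools.
Context {R : realType}.

Lemma fine_probability_bigsetU_le (d : measure_display) (Y : measurableType d)
    (P : probability Y R) (I : Type) (s : seq I) (A : I -> set Y) :
  (forall i, measurable (A i)) ->
  fine (P (\big[setU/set0]_(i <- s) A i)) <= \sum_(i <- s) fine (P (A i)).
Proof.
move=> mA; elim: s => [|i s IH]; first by rewrite !big_nil measure0.
rewrite !big_cons (le_trans (fine_probability_leU P (mA i) _)) ?lerD2l//.
exact: bigsetU_measurable.
Qed.

Lemma ergodic_averages_gt (d : measure_display) (Y : measurableType d)
    (P : probability Y R) (T : Y -> Y) (I : finType) (f : I -> Y -> R)
    (a : I -> R) (e : R) :
  measurable_fun setT T -> ergodic_measure P T ->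
  (forall i, bounded_measurable (f i)) -> (forall i, \int[P]_x f i x < a i) ->
    0 < e ->
  \forall n \near \oo,
    let bad := [set x | exists i, a i * n%:R < \sum_(k < n) f i (iter k T x)] in
    measurable bad /\ fine (P bad) < e.
Proof.
move=> mT eP bf fa e0; pose e' := e / (#|I|.+1)%:R.
have N0 : 0 < (#|I|.+1)%:R :> R by rewrite ltr0n.
have e'0 : 0 < e' by rewrite divr_gt0.
pose A i n := [set x | a i * n%:R < \sum_(k < n) f i (iter k T x)].
have : \forall n \near \oo, forall i, measurable (A i n) /\ fine (P (A i n)) < e'.
  by apply: filter_forall => i;
    exact: (ergodic_average_gt mT eP (bf i) (fa i) e'0).
apply: filterS => n HA /=.
have -> : [set x | exists i, a i * n%:R < \sum_(k < n) f i (iter k T x)] =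
    \big[setU/set0]_(i <- index_enum I) A i n.
  apply/seteqP; split => x.
    move=> [i ai]; rewrite -bigcup_seq; exists i => //=; exact: mem_index_enum.
  by rewrite -bigcup_seq => -[i _ ai]; exists i.
split; first by apply: bigsetU_measurable => i _; case: (HA i).
apply: (@le_lt_trans _ _ (\sum_(i : I) fine (P (A i n)))).
  by apply: fine_probability_bigsetU_le => i; case: (HA i).
apply: (@le_lt_trans _ _ (\sum_(i : I) e')).
  by apply: ler_sum => i _; case: (HA i) => _ /ltW.
rewrite sumr_const -[ltLHS]mulr_natr /e' mulrAC ltr_pdivrMr// ltr_pM2l//.
by rewrite ltr_nat.
Qed.

(** Disjoint closed sets in a compact space are at positive distance; near each [x] only those sets
    matter that contain [x]. The factor 2 serves two points within [e] of a common centre. *)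
Lemma closed_family_separated (X : pointedMetricType R) (I : finType) (K :
  I -> set X) :
  compact [set: X] -> (forall i, closed (K i)) ->
  (forall i j x, K i x -> K j x -> i = j) ->
  exists2 e : R, 0 < e & forall i j x y, K i x -> K j y -> mdist x y <= 2 * e
    -> i = j.
Proof.
move=> cX cK dK.
have /compact_near_coveringP cov := cX.
pose Q (n : nat) x := forall i j y, K i x -> K j y ->
  mdist x y <= 2 * n.+1%:R^-1 -> i = j.
suff H : forall x, [set: X] x -> \forall x' \near x & n \near \oo, Q n x'.
  have [n _ /(_ n (leqnn n)) Hn] := cov nat \oo Q _ H.
  by exists n.+1%:R^-1 => // i j x y; exact: (Hn x Logic.I).
move=> x _.
have : nbhs x [set y | forall j, K j y -> K j x].
  apply: filter_forall => j; have [Kx|nKx] := pselect (K j x).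
    by apply: nearW => y _.
  have : nbhs x (~` K j) by apply: open_nbhs_nbhs; split => //;
    exact: closed_openC.
  by apply: filterS => y nKy /nKy.
move=> /nbhs_ballP[r /= r0 rx].
have r20 : 0 < r / 2 by rewrite divr_gt0.
exists (ball x (r / 2), [set n | n.+1%:R^-1 < r / 4]); last first.
  move=> [x' n] [/= xx' nr] i j y Kix' Kjy x'y.
  apply: (dK i j x).
    by apply: rx Kix'; apply: le_ball xx'; lra.
  apply: rx Kjy; move: xx' nr x'y; rewrite !ballEmdist/=.
  have := metric_triangle x x' y.
  move: (n.+1%:R^-1) => q; lra.
split; first exact: nbhsx_ballx.
have r40 : 0 < r / 4 by rewrite divr_gt0.
exact: (near_infty_natSinv_lt (PosNum r40)).
Qed.

(** A generating function bound: give each word the weight [t] to the number of its entries other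
    than [None]. All weights add up to the right-hand side, and a sparse word weighs at least [t] to
    the power [B]. *)
Lemma card_sparse_ffun (m n : nat) (t B : R) : 0 < t <= 1 ->
  #|[set w : {ffun 'I_n -> option 'I_m} | (\sum_k (w k != None))%:R <= B]%SET|%:R
    * expR (B * ln t) <= (1 + m%:R * t) ^+ n.
Proof.
move=> /andP[t0 t1].
have -> : (1 + m%:R * t) ^+ n =
    \sum_(w : {ffun 'I_n -> option 'I_m}) \prod_k t ^+ (w k != None).
  rewrite -(bigA_distr_bigA (fun (_ : 'I_n) (o :
    option 'I_m) => t ^+ (o != None)))/=.
  rewrite -[in LHS](card_ord n) -prodr_const; apply: eq_bigr => k _.
  rewrite (bigD1 None)//= (eq_bigr (fun=> t)) => [|o oN]; last by rewrite oN.
  rewrite sumr_const (_ : #|_| = m); last by rewrite cardC1 card_option card_ord.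
  by rewrite mulr_natl.
rewrite [leRHS](bigID (mem [set w :
  {ffun 'I_n -> option 'I_m} | (\sum_k (w k != None))%:R <= B]%SET))/=.
rewrite -[leLHS]addr0 lerD//; last first.
  by apply: sumr_ge0 => w _; apply: prodr_ge0 => k _; rewrite exprn_ge0// ltW.
rewrite mulr_natl -sumr_const; apply: ler_sum => w; rewrite inE => wB.
have -> : \prod_k t ^+ (w k != None) = expR ((\sum_k (w k != None))%:R * ln t).
  by rewrite prodrXr expRM_natl lnK.
by rewrite ler_expR ler_wnM2r// ln_le0.
Qed.

Lemma maximal_separated (S : finType) (J : {set S}) (close : rel S) :
  reflexive close -> symmetric close ->
  exists D : {set S}, [/\ D \subset J, {in D &, forall s s', s != s' -> ~~
    close s s'} &
    {in J, forall s, exists2 s', s' \in D & close s s'}].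
Proof.
move=> rc sc.
pose sep (D : {set S}) := (D \subset J) &&
  [forall s in D, [forall s' in D, (s != s') ==> ~~ close s s']].
have sep0 : sep finset.set0.
  by rewrite /sep finset.sub0set; apply/forall_inP => s; rewrite inE.
have [D /andP[DJ /forall_inP Dsep] Dmax] :=
  @arg_maxnP _ finset.set0 sep (fun D => #|D|) sep0.
exists D; split => //.
  by move=> s s' sD s'D; have /forall_inP/(_ _ s'D)/implyP := Dsep s sD.
move=> s sJ; apply: contrapT => Hs.
have {}Hs s' : s' \in D -> ~~ close s s' by move=> s'D; apply/negP => ?;
  apply: Hs; exists s'.
have sD : s \notin D by apply/negP => /Hs; rewrite rc.
have : sep (s |: D).
  apply/andP; split; first by rewrite finset.subUset finset.sub1set sJ.
  apply/forall_inP => u; rewrite !inE => /predU1P[->|uD];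
    apply/forall_inP => v; rewrite !inE.
    by move=> /predU1P[->|vD]; [rewrite eqxx|rewrite Hs// implybT].
  move=> /predU1P[->|vD]; first by rewrite sc Hs// implybT.
  by have /forall_inP/(_ _ vD) := Dsep u uD.
by move=> /Dmax; rewrite cardsU1 sD/= ltnn.
Qed.

End lower_tools.

(** * Counting itineraries by separated points *)

Section counting.
Context {R : realType} {X : pointedMetricType R}.
Variables (T : X -> X) (m n : nat) (c : X -> 'I_m) (K : 'I_m -> set X) (G :
  set X).
Variables (eps t B : R).

Definition visited_itineraries : {set {ffun 'I_n -> 'I_m}} :=
  [set s | `[< exists2 x, G x & itinerary T c n x = s >]].

Lemma bowen_dist_sym (x y : X) : bowen_dist T n x y = bowen_dist T n y x.
Proof. by rewrite /bowen_dist; under eq_bigr do rewrite metric_sym. Qed.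

Lemma bowen_distxx (x : X) : bowen_dist T n x x = 0.
Proof.
rewrite /bowen_dist; under eq_bigr do rewrite mdistxx.
by elim/big_ind : _ => // u v -> ->; rewrite maxxx.
Qed.

Hypothesis eps_gt0 : 0 < eps.
Hypothesis t01 : 0 < t <= 1.
Hypothesis K_separated :
  forall i j x y, K i x -> K j y -> mdist x y <= 2 * eps -> i = j.
Hypothesis G_sparse : forall x, G x ->
  \sum_(k < n) \1_[set y | ~ K (c y) y] (iter k T x) <= B.

(* An itinerary is determined by a center of a Bowen ball that contains a
   representative, and by its values at the sparse times spent outside K. *)
Lemma card_visited_itineraries_le : exists E : seq X,
  [/\ uniq E, Defs.separated T n eps [set` E], [set` E] `<=` G &
     #|visited_itineraries|%:R * expR (B * ln t) <=
       (size E)%:R * (1 + m%:R * t) ^+ n].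
Proof.
set J := visited_itineraries.
have /choice[rep Hrep] (s : {ffun 'I_n -> 'I_m}) : exists x, s \in J ->
    G x /\ itinerary T c n x = s.
  have [sJ|] := boolP (s \in J); last by exists point.
  by have := sJ; rewrite inE => /asboolP[x Gx xs]; exists x.
pose close s s' := bowen_dist T n (rep s) (rep s') <= eps.
have [D [DJ Dsep Dmax]] : exists D : {set {ffun 'I_n -> 'I_m}},
    [/\ D \subset J, {in D &, forall s s', s != s' -> ~~ close s s'} &
    {in J, forall s, exists2 s', s' \in D & close s s'}].
  apply: maximal_separated => [s|s s']; first by rewrite /close bowen_distxx ltW.
  by rewrite /close bowen_dist_sym.
have DJs s : s \in D -> s \in J by move/(fintype.subsetP DJ).
have repI : {in D &, injective rep}.
  move=> s s' /DJs/Hrep[_ e] /DJs/Hrep[_ e'] rr.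
  by rewrite -e -e' rr.
exists [seq rep s | s <- enum D]; split.
- rewrite map_inj_in_uniq ?enum_uniq// => s s'; rewrite !mem_enum; exact: repI.
- move=> _ _ /= /mapP[s + ->] /mapP[s' + ->]; rewrite !mem_enum => sD s'D ss'.
  rewrite ltNge; apply: Dsep => //; apply/eqP => ss; apply: ss'; by rewrite ss.
- by move=> _ /= /mapP[s + ->]; rewrite mem_enum => /DJs/Hrep[].
rewrite size_map -cardE.
have /choice[g Hg] (s : {ffun 'I_n -> 'I_m}) :
  exists s', s \in J -> s' \in D /\ close s s'.
  have [sJ|] := boolP (s \in J); last by exists s.
  by have [s' s'D ss'] := Dmax s sJ; exists s'.
pose w (s : {ffun 'I_n -> 'I_m}) : {ffun 'I_n -> option 'I_m} :=
  [ffun k : 'I_n => if `[< K (c (iter k T (rep s))) (iter k T (rep s)) >] then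
    None else Some (s k)].
pose W : {set {ffun 'I_n -> option 'I_m}} := [set w :
  {ffun 'I_n -> option 'I_m} | (\sum_k (w k != None))%:R <= B]%SET.
have wW s : s \in J -> w s \in W.
  move=> /Hrep[/G_sparse + _]; rewrite inE; apply: le_trans.
  rewrite natr_sum; apply: ler_sum => k _; rewrite ffunE indicE.
  case: asboolP => Kx /=; first by rewrite ler0n.
  by rewrite mem_set.
have itin s (k : 'I_n) : s \in J -> c (iter k T (rep s)) = s k.
  by move=> /Hrep[_ /ffunP/(_ k)]; rewrite ffunE.
(* At a time when both orbits are in their closed cells, they are within [2 * eps] through the
   common centre, so the symbols agree by [K_separated]. At the other times [w] displays the
   symbol. *)
have fI : {in J &, injective (fun s => (g s, w s))}.
  move=> s s' sJ s'J [gg /ffunP ww]; apply/ffunP => k.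
  have := ww k; rewrite !ffunE; case: asboolP => K1; case: asboolP => K2 //;
    last by case.
  move=> _; rewrite -(itin s k sJ) -(itin s' k s'J); apply: (K_separated K1 K2).
  have [_ c1] := Hg s sJ; have [_ c2] := Hg s' s'J.
  have d1 := le_trans (le_bowen_dist T (rep s) (rep (g s)) (ltn_ord k)) c1.
  have d2 := le_trans (le_bowen_dist T (rep s') (rep (g s')) (ltn_ord k)) c2.
  have := metric_triangle (iter k T (rep s)) (iter k T (rep (g s))) (iter k T
    (rep s')).
  by move: d2; rewrite -gg (metric_sym (iter k T (rep s'))); lra.
have cJ : (#|J| <= #|D| * #|W|)%N.
  rewrite -cardsX -(card_in_imset fI); apply: subset_leq_card.
  apply/fintype.subsetP => _ /imsetP[s sJ ->]; rewrite !inE/=.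
  by have [-> _] := Hg s sJ; have := wW s sJ; rewrite inE.
have := card_sparse_ffun m n B t01; rewrite -/W => cW.
apply: (@le_trans _ _ ((#|D| * #|W|)%:R * expR (B * ln t))).
  by rewrite ler_wpM2r ?expR_ge0// ler_nat.
by rewrite natrM -mulrA ler_wpM2l.
Qed.

End counting.

Lemma measurable_label_preimage (d : measure_display) (Y : measurableType d)
    (I : finType) (c : Y -> I) (A : pred I) :
  (forall i, measurable (c @^-1` [set i])) -> measurable (c @^-1` [set` A]).
Proof.
move=> mc; rewrite (_ : _ @^-1` _ = \bigcup_(i in [set` A]) (c @^-1` [set i])).
  by apply: fin_bigcup_measurable => // i _; exact: mc.
by apply/seteqP; split => x /= => [Ax|[i Ai ->]//]; exists (c x).
Qed.

(** * The growth rate bounded below by an ergodic measure *)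

Section lower_bound.
Context {R : realType} {X : pointedMetricType R}.
Variables (T : X -> X) (d : nat) (phi : 'I_d -> X -> R) (F : 'rV[R]_d -> R).
Hypothesis X_compact : compact [set: X].
Hypothesis T_continuous : continuous T.
Hypothesis phi_continuous : forall i, continuous (phi i).
Hypothesis F_continuous : continuous F.

Lemma le_limn_esup_near (u : nat -> \bar R) (b : \bar R) :
  (\forall n \near \oo, (b <= u n)%E) -> (b <= limn_esup u)%E.
Proof.
move=> bu; apply: le_ereal_inf_tmp => _ [V ooV <-].
have [n [bn Vn]] := filter_ex (filterI bu ooV).
by apply: le_trans bn _; apply: ereal_sup_ubound; exists n.
Qed.

Lemma separated_sup_ge (n : nat) (eps r : R) (E : seq X) :
  uniq E -> Defs.separated T n eps [set` E] ->
  {in E, forall x, r <= F (birkhoff_average T phi n x)} ->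
  (((size E)%:R * expR (n%:R * r))%:E <= separated_sup T phi F n eps)%E.
Proof.
move=> Eu Es Er; apply: (@le_trans _ _ (\esum_(x in [set` E]) (weight T phi F n
  x)%:E)%E).
  apply: esum_ge; exists [set` E].
    by split => //; exact: finite_seq.
  rewrite -fsbig_seq// sumEFin lee_fin -[leLHS](_ :
    \sum_(x <- E) expR (n%:R * r) = _); last first.
    by rewrite big_const_seq count_predT iter_addr_0 -[LHS]mulr_natl.
  rewrite big_seq [leRHS]big_seq; apply: ler_sum => x xE.
  by rewrite ler_expR ler_wpM2l// Er.
by apply: ereal_sup_ubound; exists [set` E].
Qed.

Lemma exists_closed_cells (P : probability (borel X) R) (m : nat) (c :
  X -> 'I_m) (r : R) :
  (forall i, measurable (c @^-1` [set i] : set (borel X))) -> 0 < r ->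
  exists K : 'I_m -> set X, [/\ forall i, closed (K i), forall i x, K i x -> c
    x = i,
    measurable ([set x | ~ K (c x) x] : set (borel X)) &
    fine (P [set x | ~ K (c x) x]) < r].
Proof.
move=> mc r0; pose r' := r / m.+1%:R.
have N0 : 0 < m.+1%:R :> R by rewrite ltr0n.
have r'0 : 0 < r' by rewrite divr_gt0.
have /choice[K HK] i : exists K : set X, [/\ closed K, K `<=` c @^-1` [set i] &
    fine (P (c @^-1` [set i] `\` K)) < r'].
  have [K [U [cK oU KA AU UK]]] := borel_regular P (mc i) r'0.
  exists K; split => //; apply: le_lt_trans UK; apply: fine_probability_le.
  - by apply: measurableD => //; exact: closed_borel.
  - by apply: measurableD; [exact: open_borel|exact: closed_borel].
  - exact: setSD.
have mD i : measurable (c @^-1` [set i] `\` K i : set (borel X)).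
  by apply: measurableD => //; apply: closed_borel; case: (HK i).
have E : [set x | ~ K (c x) x] =
    \big[setU/set0]_(i <- index_enum 'I_m) (c @^-1` [set i] `\` K i).
  rewrite -bigcup_seq; apply/seteqP; split => x /=.
    by move=> nK; exists (c x) => //=; exact: mem_index_enum.
  by move=> [i _ [/= ->]].
exists K; split.
- by move=> i; case: (HK i).
- by move=> i x; case: (HK i) => _ + _; apply.
- by rewrite E; apply: bigsetU_measurable => i _.
rewrite E; apply: le_lt_trans (fine_probability_bigsetU_le P _ mD) _.
apply: (@le_lt_trans _ _ (\sum_(i < m) r')).
  by apply: ler_sum => i _; case: (HK i) => _ _ /ltW.
rewrite sumr_const card_ord -[ltLHS]mulr_natr /r' mulrAC ltr_pdivrMr// ltr_pM2l//.
by rewrite ltr_nat.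
Qed.

(** For large [n], [n h] is about the entropy of the n-th join; concentration on good points bounds
    this by [ln #|J|], and counting bounds [ln #|J|] by [ln (size E)], each up to a small multiple
    of [n]. On [E] the weights are at least [expR (n%:R * (F a - e))]. *)
Lemma pressure_rate_ge (P : probability (borel X) R) (m : nat) (c :
  X -> 'I_m) (e' : R) :
  ergodic_measure P T -> (forall i, measurable (c @^-1` [set i] :
    set (borel X))) ->
  0 < e' -> exists2 eps : R, 0 < eps &
    ((partition_entropy P T (fun i => c @^-1` [set i])
      + F (\row_i \int[P]_x phi i x) - e')%:E <= pressure_rate T phi F eps)%E.
Proof.
(* Six errors of size [e] occur: the entropy limit, [F], [ln 2], the bad mass, and two in counting
   sparse words. *)
move=> eP mc e'0; pose e := e' / 8; have e0 : 0 < e by rewrite divr_gt0.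
have mT : measurable_fun setT (T : borel X -> borel X) :=
  continuous_borel T_continuous.
have iP := eP.1.
set h := partition_entropy _ _ _; set a := \row_i _.
have m0 : (0 < m)%N by case: (m) (c point) => // -[].
have M0 : 0 < m%:R :> R by rewrite ltr0n.
have [delta delta0 Fdelta] : exists2 delta : R, 0 < delta &
    forall u, ball a delta u -> `|F a - F u| < e.
  by have /cvgrPdist_lt/(_ _ e0)/nbhs_ballP[r /= r0 Hr] := F_continuous (x :=
    a); exists r.
(* Makes [ln (1 + m%:R * t)] at most [e]. *)
pose t := Num.min 1 (e / m%:R).
have t0 : 0 < t by rewrite lt_min ltr01 divr_gt0.
have t1 : t <= 1 by rewrite ge_min lexx.
have mt : m%:R * t <= e.
  by rewrite mulrC -ler_pdivlMr// ge_min lexx orbT.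
have lnt : 0 <= - ln t by rewrite oppr_ge0 ln_le0.
(* The allowed frequency of times outside the closed cells, chosen so that the factor
   [expR (B * ln t)] with [B = theta * n] costs at most [e * n]. The added 1 keeps the denominator
   positive when [t = 1]. *)
pose theta := e / (1 - ln t).
have t'0 : 0 < 1 - ln t by lra.
have theta0 : 0 < theta by rewrite divr_gt0.
have theta_t : theta * - ln t <= e.
  by rewrite /theta mulrAC ler_pdivrMr// ler_pM2l//; lra.
have lnm : 0 <= ln m%:R :> R by rewrite ln_ge0// ler1n.
(* Mass of the bad points: they contribute at most [eta * n * ln m], and [eta < 1] leaves some good
   points. The added 1 covers [m = 1]. *)
pose eta := Num.min (1 / 2) (e / (1 + ln m%:R)).
have eta0 : 0 < eta by rewrite lt_min !divr_gt0//; lra.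
have eta1 : eta < 1 by rewrite gt_min; apply/orP; left; lra.
have eta_m : eta * ln m%:R <= e.
  have : eta <= e / (1 + ln m%:R) by rewrite ge_min lexx orbT.
  rewrite ler_pdivlMr; last lra.
  by apply: le_trans; rewrite ler_pM2l//; lra.
have [K [cK Kc mK PK]] := exists_closed_cells P mc theta0.
have [eps eps0 Ksep] : exists2 eps : R, 0 < eps &
    forall i j x y, K i x -> K j y -> mdist x y <= 2 * eps -> i = j.
  by apply: closed_family_separated => // i j x /Kc <- /Kc.
exists eps => //.
(* One family for the one-sided ergodic theorem: [None] controls the time outside the closed cells,
   and the two signs of each [phi i] give a two-sided bound on its averages. *)
pose f (o : option ('I_d * bool)) : borel X -> R := match o with
  | None => \1_[set x | ~ K (c x) x]
  | Some (i, true) => phi i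
  | Some (i, false) => fun x => -1 * phi i x end.
pose al (o : option ('I_d * bool)) : R := match o with
  | None => theta
  | Some (i, true) => a ord0 i + delta / 2
  | Some (i, false) => - a ord0 i + delta / 2 end.
have d20 : 0 < delta / 2 by rewrite divr_gt0.
have bphi i := continuous_bounded_measurable X_compact (phi_continuous (i := i)).
have bf o : bounded_measurable (f o).
  case: o => [[i []]|] /=; last exact: bounded_measurable_indic.
    exact: bphi.
  exact: bounded_measurableZ.
have If o : \int[P]_x f o x < al o.
  case: o => [[i []]|] /=; last by rewrite Rintegral_indic.
    by rewrite /a mxE; lra.
  rewrite RintegralZl//; last exact: bounded_measurable_integrable.
  by rewrite /a mxE; lra.
have LLN := ergodic_averages_gt mT eP bf If eta0.
apply: le_limn_esup_near.
have Hcvg := partition_entropy_label_cvg mT mc iP.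
have Hnear : \forall n \near \oo, h - e <
    label_entropy (fine \o P) (itinerary T c n) / n%:R.
  by apply: (cvgr_gt _ Hcvg); rewrite ltrBlDr ltrDl.
near=> n.
have n0 : (0 < n)%N by near: n; exists 1%N.
have N0 : 0 < n%:R :> R by rewrite ltr0n.
have Hn : h - e < label_entropy (fine \o P) (itinerary T c n) / n%:R by near: n.
have ln2n : ln 2 <= e * n%:R.
  by rewrite -ler_pdivrMl// mulrC; near: n; exact: nbhs_infty_ger.
have : let bad := [set x | exists o, al o * n%:R < \sum_(k < n) f o (iter k T
  x)] in
    measurable (bad : set (borel X)) /\ fine (P bad) < eta by near: n.
set bad := [set x | _] => -[mbad Pbad].
have good x : (~` bad) x -> forall o, \sum_(k < n) f o (iter k T x) <= al o *
  n%:R.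
  by move=> nb o; rewrite leNgt; apply/negP => lt; apply: nb; exists o.
have t01 : 0 < t <= 1 by rewrite t0.
have [E [Eu Esep EG cardE]] := card_visited_itineraries_le eps0 t01 Ksep
  (fun x gx => good x gx None).
set J := visited_itineraries _ _ _ _ in cardE.
have pA := probability_fin_additive P.
have mit := measurable_itinerary mT mc (n := n).
have HJ : label_entropy (fine \o P) (itinerary T c n) <=
    ln 2 + ln #|J|%:R + eta * ln #|{ffun 'I_n -> 'I_m}|%:R.
  apply: shannon_le_concentrated => //; first by move=> s; exact: fadd_ge0 pA _.
    exact: (fadd_sum1 pA).
  have sumE := @fadd_preimage R _ _ _ pA _ (itinerary T c n) (mem (~: J)%SET) mit.
  rewrite -[leLHS]sumE; apply: ltW; apply: le_lt_trans Pbad.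
  apply: fine_probability_le => //.
    exact: measurable_label_preimage.
  move=> x /=; rewrite !inE => /asboolP nJ; apply: contrapT => gx; apply: nJ.
  by exists x.
have J0 : (0 < #|J|)%N.
  have [x gx] : exists x, (~` bad) x.
    apply: contrapT => /forallNP nob; move: Pbad.
    have -> : bad = setT by apply/seteqP; split => // x _;
      exact: contrapT (nob x).
    by rewrite [X in X < _](fadd_total pA) ltNge (ltW eta1).
  apply/card_gt0P; exists (itinerary T c n x); rewrite inE; apply/asboolP.
  by exists x.
have J0R : 0 < #|J|%:R :> R by rewrite ltr0n.
have E0 : (0 < size E)%N.
  rewrite lt0n; apply/eqP => E0; move: cardE; rewrite E0 mul0r leNgt.
  by rewrite mulr_gt0// expR_gt0.
have E0R : 0 < (size E)%:R :> R by rewrite ltr0n.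
have EF : {in E, forall x, F a - e <= F (birkhoff_average T phi n x)}.
  move=> x xE; have gx := good x (EG x xE).
  have : ball a delta (birkhoff_average T phi n x).
    split => // i j; rewrite (ord1 i) /ball/= !mxE.
    have := gx (Some (j, true)); have := gx (Some (j, false)); rewrite /=.
    rewrite -mulr_sumr mulN1r -/(birkhoff_sum T n (phi j) x).
    set y := birkhoff_sum T n (phi j) x / n%:R.
    have -> : birkhoff_sum T n (phi j) x = y * n%:R by rewrite divfK// gt_eqF.
    rewrite -mulNr !ler_pM2r// => H1 H2.
    move: H1 H2; rewrite /al /a mxE ltr_norml => H1 H2.
    by apply/andP; split; lra.
  by move=> /Fdelta; rewrite ltr_norml; lra.
have := separated_sup_ge Eu Esep EF.
set S := separated_sup _ _ _ _ _ => HS.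
have lnS : ((ln (size E)%:R + n%:R * (F a - e))%:E <= lne S)%E.
  have pos : 0 < (size E)%:R * expR (n%:R * (F a - e)) by rewrite mulr_gt0
    ?expR_gt0.
  rewrite -[X in ln _ + X]expRK -lnM ?posrE ?expR_gt0// -lne_EFin//.
  rewrite lee_lne// in_itv/= leey andbT ?lee_fin ?(ltW pos)//.
  by apply: le_trans HS; rewrite lee_fin ltW.
apply: (@le_trans _ _ ((n%:R^-1)%:E * (ln (size E)%:R + n%:R * (F a -
  e))%:E)%E); last first.
  by rewrite lee_wpmul2l// lee_fin invr_ge0.
rewrite -EFinM lee_fin -(ler_pM2l N0) mulrA divff ?gt_eqF// mul1r.
have cardW : ln #|J|%:R <= ln (size E)%:R + 2 * e * n%:R.
  have mt0 : 0 < 1 + m%:R * t by rewrite ltr_pwDl// mulr_ge0// ltW.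
  move: cardE; rewrite -ler_ln ?posrE ?mulr_gt0 ?expR_gt0 ?exprn_gt0//.
  rewrite lnM ?posrE ?expR_gt0// expRK lnM ?posrE ?exprn_gt0// lnXn// -mulr_natl.
  have : ln (1 + m%:R * t) <= e.
    by apply: le_trans mt; apply: le_ln1Dx;
      rewrite (lt_le_trans (ltrN10 _))// mulr_ge0// ltW.
  rewrite -(ler_pM2l N0) => H1.
  have : theta * n%:R * - ln t <= e * n%:R by rewrite mulrAC ler_pM2r.
  move: H1; rewrite /al mulrN; lra.
have lnM : ln #|{ffun 'I_n -> 'I_m}|%:R = n%:R * ln m%:R :> R.
  by rewrite card_ffun !card_ord natrX lnXn// -[LHS]mulr_natl.
move: Hn; rewrite ltr_pdivlMr// => Hn.
have : eta * (n%:R * ln m%:R) <= e * n%:R by rewrite mulrCA mulrC ler_pM2r.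
have e'E : e' = 8 * e by rewrite /e; field.
move: HJ; rewrite lnM e'E; move: Hn cardW ln2n; rewrite /h mulrBl !mulrDr mulrN.
have : 0 <= e * n%:R by rewrite mulr_ge0// ltW.
lra.
Unshelve. all: by end_near. Qed.

End lower_bound.

(** * The variational principle *)

Section variational_principle.
Context {R : realType} {X : pointedMetricType R}.
Variables (T : X -> X) (d : nat) (phi : 'I_d -> X -> R) (F : 'rV[R]_d -> R).
Hypothesis X_compact : compact [set: X].
Hypothesis T_continuous : continuous T.
Hypothesis phi_continuous : forall i, continuous (phi i).
Hypothesis F_continuous : continuous F.

Lemma separated_sup_antitone (n : nat) (e e' : R) : e <= e' ->
  (separated_sup T phi F n e' <= separated_sup T phi F n e)%E.
Proof.
move=> ee'; apply: ge_ereal_sup => _ [E sE <-]; apply: ereal_sup_ubound;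
  exists E => //.
by move=> x y Ex Ey xy; apply: le_lt_trans ee' _; exact: sE.
Qed.

Lemma separated_sup_ge0 (n : nat) (e : R) : (0 <= separated_sup T phi F n e)%E.
Proof.
apply: ereal_sup_ubound; exists set0; first by move=> x y [].
by rewrite esum_set0.
Qed.

Lemma pressure_rate_antitone (e e' : R) : e <= e' ->
  (pressure_rate T phi F e' <= pressure_rate T phi F e)%E.
Proof.
move=> ee'; apply: le_ereal_inf_tmp => _ [V ooV <-].
apply: le_trans (_ : _ <= ereal_sup ((fun n => (n%:R^-1)%:E * lne
  (separated_sup T phi F n e'))%E @` V))%E _.
  by apply: ereal_inf_lbound; exists V.
apply: ge_ereal_sup => _ [n Vn <-].
apply: (@le_trans _ _ ((n%:R^-1)%:E * lne (separated_sup T phi F n e))%E);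
  last first.
  by apply: ereal_sup_ubound; exists n.
rewrite lee_wpmul2l// ?lee_fin ?invr_ge0//.
by rewrite lee_lne ?separated_sup_antitone// in_itv/= leey separated_sup_ge0.
Qed.

(** A nonincreasing function has its supremum over a right neighbourhood of 0, here []0, 1[], as its
    limit at 0 from the right. *)
Lemma nonlinear_pressure_sup : nonlinear_pressure T phi F =
  ereal_sup [set pressure_rate T phi F e | e in `]0, 1[%classic].
Proof.
apply/cvg_lim => //; apply: nonincreasing_at_right_cvge;
  first by rewrite bnd_simp.
by move=> e e' _ _ ee'; exact: pressure_rate_antitone.
Qed.

Lemma ergodic_entropy_le (P : probability (borel X) R) : ergodic_measure P T ->
  (ks_entropy P T + (F (\row_i \int[P]_x phi i x))%:E <= nonlinear_pressure T
    phi F)%E.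
Proof.
move=> eP; rewrite -leeBrDr//; apply: ge_ereal_sup => _ [m [A [fA ->]]].
rewrite leeBrDr//; apply/lee_addgt0Pr => e e0; rewrite -EFinD -leeBlDr// -EFinB.
have [mA _ _] := fA; have [c cE] := finite_partitionP fA; rewrite {}cE in mA *.
have [eps eps0 le] := pressure_rate_ge X_compact T_continuous phi_continuous
  F_continuous eP mA e0.
apply: le_trans le _; rewrite nonlinear_pressure_sup.
apply: (@le_trans _ _ (pressure_rate T phi F (Num.min eps (1 / 2)))).
  by apply: pressure_rate_antitone; rewrite ge_min lexx.
apply: ereal_sup_ubound; exists (Num.min eps (1 / 2)) => //=.
by rewrite in_itv/= lt_min gt_min eps0 divr_gt0//=; apply/orP; right; lra.
Qed.

End variational_principle.

Theorem theorem2 (R : realType) (X : pointedMetricType R) (T : X -> X)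
    (d : nat) (phi : 'I_d -> X -> R) (F : 'rV[R]_d -> R)
    (d_gt0 : (0 < d)%N)
    (X_compact : compact [set: X])
    (T_continuous : continuous T)
    (phi_continuous : forall i, continuous (phi i))
    (F_continuous : continuous F)
    (T_phi_abundant : abundance_of_ergodic_measures T phi) :
  nonlinear_pressure T phi F =
  ereal_sup [set (ks_entropy mu T + (F (\row_i \int[mu]_x phi i x))%:E)%E
    | mu in invariant_borel_measures T].
Proof.
apply/eqP; rewrite eq_le; apply/andP; split.
  rewrite nonlinear_pressure_sup; apply: ge_ereal_sup => _ [e + <-].
  by rewrite /= in_itv/= => /andP[e0 _]; exact: pressure_rate_le.
apply: ge_ereal_sup => _ [mu imu <-]; apply/lee_addgt0Pr => e e0.
have e20 : 0 < e / 2 by rewrite divr_gt0.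
set a := \row_i _.
have [r r0 Fr] : exists2 r :
  R, 0 < r & forall u, ball a r u -> `|F a - F u| < e / 2.
  have /cvgrPdist_lt/(_ _ e20)/nbhs_ballP[r /= r0 Hr] := F_continuous a.
  by exists r.
(* Abundance uses one tolerance for both conclusions: [r] serves the continuity of [F], and [e / 2]
   is the entropy loss. *)
have de0 : 0 < Num.min r (e / 2) by rewrite lt_min r0.
have [nu [enu hnu inu]] := T_phi_abundant mu _ imu de0.
have Fnu : F a - e / 2 < F (\row_i \int[nu]_x phi i x).
  suff /Fr : ball a r (\row_i \int[nu]_x phi i x) by rewrite ltr_norml =>
    /andP[_]; lra.
  split => // i j; rewrite (ord1 i) /ball/= !mxE distrC;
    apply: lt_le_trans (inu j) _.
  by rewrite ge_min lexx.
have := ergodic_entropy_le X_compact T_continuous phi_continuous F_continuous enu.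
move=> /(leeD2r e%:E); apply: le_trans.
move: hnu; rewrite leeBlDr// => hnu.
apply: (@le_trans _ _ (ks_entropy nu T + (Num.min r (e / 2))%:E + (F a)%:E)%E).
  exact: leeD2r.
rewrite -!addeA leeD2l// -!EFinD lee_fin.
have : Num.min r (e / 2) <= e / 2 by rewrite ge_min lexx orbT.
lra.
Qed.
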